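(* Fix positive integers $n$, $d$ and $x$. (i) If either $n=1$ or $d=2$, then $\mathbb{T}(n,d;x)=\emptyset$ for any $x$. (ii) $\mathbb{T}(2,3;x)=\emptyset$ for any $x$. (iii) If $n\ge 2$, $d\ge 3$ and $(n,d)\ne (2,3)$, then $\mathbb{T}(n,d;x)\ne\emptyset$ if and only if $x\ge n+\lceil d/2\rceil$.
   Context: We work over an algebraically closed field of characteristic $0$. For a finite set $S\subset\mathbb{P}^n$, $\langle S\rangle$ is its linear span, and $2S\subset\mathbb{P}^n$ is the zero-dimensional scheme defined by the ideal sheaf $(\mathcal{I}_S)^2$, i.e. the union of the double points supported at the points of $S$. For a closed subscheme $Z\subset\mathbb{P}^n$, $h^i(\mathcal{I}_Z(d))=\dim H^i(\mathbb{P}^n,\mathcal{I}_Z(d))$. The Terracini locus $\mathbb{T}(n,d;x)$ is the set of all subsets $S\subset\mathbb{P}^n$ of cardinality $x$ such that $h^0(\mathcal{I}_{2S}(d))>0$, $h^1(\mathcal{I}_{2S}(d))>0$ and $\langle S\rangle=\mathbb{P}^n$. *)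

(* Defs.v *)
From mathcomp Require Import all_boot all_order all_algebra.
From mathcomp Require Import finmap mpoly.

Set Implicit Arguments.
Unset Strict Implicit.
Unset Printing Implicit Defensive.

Import GRing.Theory.

Local Open Scope ring_scope.

Definition proj_space (K : fieldType) (n : nat) : Type :=
  {L : {vspace 'rV[K]_n.+1} | \dim L == 1%N}.

Section Defs.

Variables (K : fieldType) (n : nat).

Implicit Types (S : {fset proj_space K n}) (I : {mpoly K[n.+1]} -> Prop).

Definition spans S : Prop := (\sum_(p <- S) val p)%VS = fullv.

(* The ideal of the affine cone over S; as K will be infinite, it is the
   homogeneous ideal of S. *)
Definition vanishing_ideal S (f : {mpoly K[n.+1]}) : Prop :=
  forall p, p \in S -> forall v, v \in val p -> f.@[fun i => v 0 i] = 0.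

Definition ideal_square I (f : {mpoly K[n.+1]}) : Prop :=
  exists (m : nat) (a b : 'I_m -> {mpoly K[n.+1]}),
    [/\ forall i, I (a i), forall i, I (b i) & f = \sum_i a i * b i].

Definition double_ideal S := ideal_square (vanishing_ideal S).

(* Below, I is a homogeneous ideal, I~ is the associated sheaf on P^n and U_i is
   the chart X_i != 0. *)

(* Sections of I~(d) over the intersection of the U_(s k), k <= p: the degree d
   part of the localization of I at the product of the variables X_(s k). *)
Definition is_section I (d p : nat) (s : {ffun 'I_p.+1 -> 'I_n.+1})
    (g : {fraction {mpoly K[n.+1]}}) : Prop :=
  exists (m : nat) (f : {mpoly K[n.+1]}),
    [/\ I f, f \is (d + m * p.+1).-homog
      & g = tofrac f / tofrac ((\prod_k 'X_(s k)) ^+ m)].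

(* Cech cochains for the cover (U_i), indexed by all tuples of indices (not
   only the increasing ones). *)
Definition cochain (p : nat) : Type :=
  {ffun {ffun 'I_p.+1 -> 'I_n.+1} -> {fraction {mpoly K[n.+1]}}}.

Definition is_cochain I (d p : nat) (g : cochain p) : Prop :=
  forall s, is_section I d s (g s).

Definition face (p : nat) (s : {ffun 'I_p.+2 -> 'I_n.+1}) (k : 'I_p.+2)
  : {ffun 'I_p.+1 -> 'I_n.+1} := [ffun j => s (lift k j)].

Definition differential (p : nat) (g : cochain p) : cochain p.+1 :=
  [ffun s => \sum_(k < p.+2) (-1) ^+ k * g (face s k)].

Definition is_cocycle I (d p : nat) (g : cochain p) : Prop :=
  is_cochain I d g /\ differential g = [ffun=> 0].

Definition is_coboundary I (d p : nat) : cochain p -> Prop :=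
  match p return cochain p -> Prop with
  | 0 => fun g => g = [ffun=> 0]
  | q.+1 => fun g => exists2 h : cochain q, is_cochain I d h & g = differential h
  end.

(* h^p(I~(d)) > m, i.e. there are m + 1 cocycles which are linearly independent
   modulo coboundaries.  The standard cover is affine, so that Cech cohomology
   is the sheaf cohomology on P^n. *)
Definition h_gt I (d p m : nat) : Prop :=
  exists c : 'I_m.+1 -> cochain p,
    (forall i, is_cocycle I d (c i)) /\
    (forall a : 'I_m.+1 -> K,
       is_coboundary I d [ffun s => \sum_i tofrac (a i)%:MP * c i s] ->
       forall i, a i = 0).

Definition terracini (d x : nat) S : Prop :=
  [/\ #|` S|%fset = x,
      h_gt (double_ideal S) d 0 0,
      h_gt (double_ideal S) d 1 0
    & spans S].

End Defs.

(* Main.v *)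
Require Import Defs.
From mathcomp Require Import all_boot all_order all_algebra.
From mathcomp Require Import finmap mpoly.
From mathcomp Require Import ring zify.

(** Everything is reduced to explicit algebra with forms; no derivative is
    taken.  A form f is doubly vanishing at p if u * f lies in the square of
    the ideal of p for some form u with u(p) <> 0 ([double_at]).

    H^0.  Nonzero global sections of the sheaf of the squared ideal are
    forms of degree d doubly vanishing at S ([h0_gives_form]).  On the
    line w + t v through a point v of S such a form has degree at most d - 2
    in t.  For d = 2 it is therefore invariant under the translations by S,
    hence zero; for n = 1 it has x - 1 further double roots on such a line,
    whence 2x <= d; for (n, d) = (2, 3) it is affine in each coordinate of a
    basis taken from S, hence a multiple of the product of the coordinates,
    which is singular at three points only, so x <= 3.

    H^1 vanishes if S spans and 2x < 2n + d ([h1_vanishing]).  At p in S, a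
    hyperplane through n independent points of S not containing p, together
    with one hyperplane through each of the remaining x - 1 - n points, gives a
    form k of degree x - n vanishing on S except at p.  As 2(x - n) <= d - 1,
    the square of k can be completed to a form E of degree d - 1 that does not
    vanish at p, and the products E * l with l linear take every value to first
    order at p while vanishing doubly at the rest of S.  A cocycle is a
    difference of Laurent forms g_j - g_i since H^1 of the line bundle is zero
    ([cocycle_splits]); a sum of such products corrects the g_i so that they
    lie in the localized squared ideals ([saturation]).  The inequality
    2x < 2n + d follows from the bounds on x found in the cases n = 1 and
    (n, d) = (2, 3), and from x < n + ceil(d/2) in general.

    Existence.  If x >= n + ceil(d/2), take r = x - n + 1 points e_a + k e_b on
    a line together with the n - 1 other coordinate points.  A monomial that is
    doubly vanishing on them gives H^0.  Let P be the product of the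
    X_b - k X_a, k < r.  Since 2r >= d + 2, there is beta > 0 such that
    P^2 / (X_a X_b^beta) has degree d; it is the (a, b) component of a cocycle
    of the squared ideal.  Restricted to the line, where elements of the squared
    ideal are multiples of P^2, it would give
    1 / (X_a X_b^beta) = u_b / X_b^m - u_a / X_a^m if it were a coboundary,
    which is impossible ([no_mixed_pole]). *)

Set Implicit Arguments.
Unset Strict Implicit.
Unset Printing Implicit Defensive.

Import GRing.Theory.
Local Open Scope ring_scope.

Local Notation ev f v := (f.@[fun i => v 0 i]).

(** * Squares of ideals *)

Section Squares.
Variables (K : fieldType) (n : nat).
Local Notation R := {mpoly K[n.+1]}.
Implicit Types (I J : R -> Prop) (f g : R).

Lemma ideal_square_mul I f g : I f -> I g -> ideal_square I (f * g).
Proof.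
move=> If Ig; exists 1%N, (fun=> f), (fun=> g); split=> //.
by rewrite big_ord1.
Qed.

Lemma ideal_square0 I : ideal_square I 0.
Proof.
by exists 0%N, (fun=> 0), (fun=> 0); split=> [[]|[]|]; rewrite ?big_ord0.
Qed.

Lemma ideal_squareD I f g :
  ideal_square I f -> ideal_square I g -> ideal_square I (f + g).
Proof.
move=> [m1 [a1 [b1 [Ia1 Ib1 ->]]]] [m2 [a2 [b2 [Ia2 Ib2 ->]]]].
exists (m1 + m2)%N, (fun i => match split i with inl j => a1 j | inr j => a2 j end),
  (fun i => match split i with inl j => b1 j | inr j => b2 j end).
split=> [i|i|]; try by case: (split i).
rewrite big_split_ord /=; congr (_ + _); apply: eq_bigr => i _.
  by rewrite (unsplitK (inl i : 'I_m1 + 'I_m2)).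
by rewrite (unsplitK (inr i : 'I_m1 + 'I_m2)).
Qed.

(** If h carries I into J then its square carries the square of I into that
    of J: one factor h is given to each factor of every product a_i * b_i. *)
Lemma ideal_square_transport I J f h : (forall g, I g -> J (h * g)) ->
  ideal_square I f -> ideal_square J (h ^+ 2 * f).
Proof.
move=> IJ [m [a [b [Ia Ib ->]]]].
exists m, (fun i => h * a i), (fun i => h * b i); split=> [i|i|]; try exact: IJ.
by rewrite mulr_sumr; apply: eq_bigr => i _; ring.
Qed.

Lemma ideal_square_mono I J f :
  (forall g, I g -> J g) -> ideal_square I f -> ideal_square J f.
Proof.
move=> IJ /(@ideal_square_transport _ J _ 1).
by rewrite expr1n mul1r; apply=> g; rewrite mul1r; apply: IJ.
Qed.

Lemma ideal_squareM I f h : (forall g, I g -> I (h * g)) ->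
  ideal_square I f -> ideal_square I (h * f).
Proof.
move=> IM [m [a [b [Ia Ib ->]]]]; exists m, (fun i => h * a i), b.
split=> // [i|]; first exact: IM.
by rewrite mulr_sumr; apply: eq_bigr => i _; rewrite mulrA.
Qed.

End Squares.

(** * Points, forms and double vanishing at a point *)

Section Points.
Variables (K : fieldType) (n : nat).
Local Notation R := {mpoly K[n.+1]}.
Local Notation V := 'rV[K]_n.+1.
Local Notation Pn := (proj_space K n).
Implicit Types (f g u : R) (p q : Pn) (S : {fset Pn}) (v w : V).

Definition rep p : V := vpick (val p).

Lemma rep_neq0 p : rep p != 0.
Proof. by rewrite vpick0 -dimv_eq0 (eqP (valP p)). Qed.

Lemma mem_rep p : rep p \in val p.
Proof. exact: memv_pick. Qed.

Lemma line_rep p : val p = <[rep p]>%VS.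
Proof.
apply/esym/eqP; rewrite eqEdim -memvE memv_pick dim_vline rep_neq0.
by rewrite (eqP (valP p)).
Qed.

Lemma lineP p v : reflect (exists c, v = c *: rep p) (v \in val p).
Proof. rewrite line_rep; exact: vlineP. Qed.

Lemma vline_dim1 w (w0 : w != 0) : \dim <[w]> == 1%N.
Proof. by rewrite dim_vline w0. Qed.

Lemma mem_line_eq p v : v \in val p -> v != 0 -> val p = <[v]>%VS.
Proof.
move=> vp v0; apply/esym/eqP; rewrite eqEdim -memvE vp dim_vline v0.
by rewrite (eqP (valP p)).
Qed.

Lemma rep_in_eq p q : rep q \in val p -> p = q.
Proof.
move=> h; apply: val_inj.
by rewrite (mem_line_eq h (rep_neq0 q)) [val q]line_rep.
Qed.

Lemma homog_evZ d f c v : f \is d.-homog -> ev f (c *: v) = c ^+ d * ev f v.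
Proof.
move=> hf; rewrite !mevalE mulr_sumr; apply: eq_big_seq => m /(dhomogP _ _ _ hf) /=.
rewrite mdegE => <-; rewrite mulrCA; congr (_ * _).
rewrite -prodrXr -big_split /=; apply: eq_bigr => i _.
by rewrite mxE exprMn.
Qed.

Definition vanish_at p f := forall v, v \in val p -> ev f v = 0.

Lemma vanish_atM p f g : vanish_at p g -> vanish_at p (f * g).
Proof. by move=> h v vp; rewrite mevalM h ?mulr0. Qed.

Lemma vanish_atB p f g : vanish_at p f -> vanish_at p g -> vanish_at p (f - g).
Proof. by move=> h1 h2 v vp; rewrite mevalB h1 ?h2 ?subr0. Qed.

Lemma vanish_at_homog p f d :
  f \is d.-homog -> ev f (rep p) = 0 -> vanish_at p f.
Proof. by move=> hf h v /lineP[c ->]; rewrite (homog_evZ _ _ hf) h mulr0. Qed.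

(** Membership of f in the localization at p of the squared ideal of p: being
    closed under cancellation of forms not vanishing at p, this is insensitive
    to the denominators of sections. *)
Definition double_at p f := exists u d,
  [/\ u \is d.-homog, ev u (rep p) != 0 & ideal_square (vanish_at p) (u * f)].

Lemma square_vanish_atM p f g :
  ideal_square (vanish_at p) g -> ideal_square (vanish_at p) (f * g).
Proof. by apply: ideal_squareM => h; apply: vanish_atM. Qed.

Lemma square_double_at p f : ideal_square (vanish_at p) f -> double_at p f.
Proof.
by move=> h; exists 1, 0%N; rewrite mul1r dhomog1 meval1 oner_neq0.
Qed.

Lemma double_atD p f g : double_at p f -> double_at p g -> double_at p (f + g).
Proof.
move=> [u [d [hu u0 uf]]] [u' [d' [hu' u'0 uf']]]; exists (u * u'), (d + d')%N.
rewrite dhomogM // mevalM mulf_neq0 //; split=> //.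
have -> : u * u' * (f + g) = u' * (u * f) + u * (u' * g) by ring.
by apply: ideal_squareD; apply: square_vanish_atM.
Qed.

Lemma double_atM p f g : double_at p g -> double_at p (f * g).
Proof.
move=> [u [d [hu u0 uf]]]; exists u, d; split=> //.
by rewrite mulrCA; apply: square_vanish_atM.
Qed.

Lemma double_at_cancel p f g d : f \is d.-homog -> ev f (rep p) != 0 ->
  double_at p (f * g) -> double_at p g.
Proof.
move=> hf f0 [u [e [hu u0 uf]]]; exists (u * f), (e + d)%N.
by rewrite dhomogM // mevalM mulf_neq0 // -mulrA.
Qed.

Lemma double_ideal_at S f p : p \in S -> double_ideal S f -> double_at p f.
Proof.
move=> pS h; apply: square_double_at; move: h; apply: ideal_square_mono => g Sg.
exact: Sg.
Qed.

Lemma double_idealM S f g : double_ideal S g -> double_ideal S (f * g).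
Proof.
by apply: ideal_squareM => h Sh p pS v vp; rewrite mevalM (Sh p) ?mulr0.
Qed.

Lemma homogX1 i : ('X_i : R) \is 1.-homog.
Proof. rewrite dhomogX; exact/eqP/mdeg1. Qed.

Lemma homogXn i k : ('X_i ^+ k : R) \is k.-homog.
Proof. by rewrite -{2}(mul1n k); apply: dhomogMn; apply: homogX1. Qed.

Lemma rep_coord p : exists i, rep p 0 i != 0.
Proof.
have := rep_neq0 p; case/rV0Pn=> i h; by exists i.
Qed.

(** The form is a coordinate of the component of its argument along a
    complement of W, chosen so that this coordinate of v is nonzero. *)
Lemma linear_separation (W : {vspace V}) v : v \notin W ->
  exists l : R, [/\ l \is 1.-homog, forall w, w \in W -> ev l w = 0 & ev l v != 0].
Proof.
move=> vW.
pose phi w := w - projv W w.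
have phiW w : (phi w == 0) = (w \in W).
  apply/idP/idP => [|wW]; last by rewrite /phi projv_id // subrr eqxx.
  rewrite /phi subr_eq0 => /eqP ->; apply: memv_proj.
have /rV0Pn[j hj] : phi v != 0 by rewrite phiW.
pose l : R := \sum_k (phi (delta_mx 0 k)) 0 j *: 'X_k.
have evl w : ev l w = phi w 0 j.
  rewrite /l raddf_sum /= [in RHS](row_sum_delta w) /phi linear_sum /= -sumrB summxE.
  by apply: eq_bigr => k _; rewrite mevalZ mevalXU linearZ /= -scalerBr [RHS]mxE mulrC.
exists l; split; last by rewrite evl.
  by apply: rpred_sum => k _; apply: rpredZ; apply: homogX1.
by move=> w wW; move: wW; rewrite evl -phiW => /eqP ->; rewrite mxE.
Qed.

(** One may enlarge W by the points of s as long as the span avoids p: these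
    points cost no degree and raise the dimension of W + val p by at most one.
    A point q with p in W + q lies in W + p by exchange, so it does not raise
    the dimension, and it is killed by a linear form of its own.  Whence the
    bound on the degree e. *)
Lemma separation_form p (s : seq Pn) (W : {vspace V}) :
  rep p \notin W -> p \notin s ->
  exists k e, [/\ (k : R) \is e.-homog,
   (e + \dim (W + val p + \sum_(q <- s) val q) <= 1 + size s + \dim (W + val p))%N,
   forall w, w \in W -> ev k w = 0, forall q, q \in s -> vanish_at q k
   & ev k (rep p) != 0].
Proof.
elim: s W => [|q s IH] W pW.
  have [l [h1 h2 h3]] := linear_separation pW.
  by exists l, 1%N; split=> //; rewrite big_nil addv0 /=.
rewrite inE negb_or => /andP[pq ps].
have [pWq|pWq] := boolP (rep p \in (W + val q)%VS).
  have qWp : (val q <= W + val p)%VS.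
    have /memv_addP[w wW [w' w'q E]] := pWq.
    have w'0 : w' != 0.
      by apply: contraNneq pW => w'0; rewrite E w'0 addr0.
    rewrite (mem_line_eq w'q w'0) -memvE.
    have -> : w' = (- w) + rep p by rewrite E addrA addNr add0r.
    by apply: memv_add; [rewrite memvN | rewrite mem_rep].
  have [k [e [h1 h2 h3 h4 h5]]] := IH W pW ps.
  have pnq : rep p \notin val q by apply: contraNN pq => /rep_in_eq ->.
  have [l [l1 l2 l3]] := linear_separation pnq.
  exists (l * k), (1 + e)%N; split.
  - exact: dhomogM.
  - rewrite big_cons addvA (addv_idPl qWp) /=; move: h2; move: (\dim _) (\dim _) => a b; lia.
  - by move=> w wW; rewrite mevalM h3 ?mulr0.
  - move=> q'; rewrite inE => /orP[/eqP->|qs]; last exact/vanish_atM/h4.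
    by rewrite mulrC; apply: vanish_atM => v; apply: l2.
  - by rewrite mevalM mulf_neq0.
have [k [e [h1 h2 h3 h4 h5]]] := IH _ pWq ps.
exists k, e; split=> //.
- rewrite big_cons.
  have -> : (W + val p + (val q + \sum_(q <- s) val q)
             = W + val q + val p + \sum_(q <- s) val q)%VS.
    by rewrite !addvA -(addvA W) (addvC (val p)) addvA.
  have [+ _] := dimv_add_leqif (W + val p) (val q).
  rewrite (eqP (valP q)) -addvA (addvC (val p)) addvA.
  by move: h2 => /=; move: (\dim _) (\dim _) (\dim _) => a b c; lia.
- by move=> w wW; apply: h3; rewrite -[w]addr0 memv_add ?mem0v.
- move=> q'; rewrite inE => /orP[/eqP->|]; last exact: h4.
  by move=> v vq; apply: h3; rewrite -[v]add0r memv_add ?mem0v.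
Qed.

End Points.

(** * Local membership and saturation *)

Section Local.
Variables (K : fieldType) (n : nat).
Local Notation R := {mpoly K[n.+1]}.
Local Notation V := 'rV[K]_n.+1.
Local Notation Pn := (proj_space K n).
Implicit Types (f g u : R) (p q : Pn) (S : {fset Pn}) (v w : V).

Lemma separate_point S p : p \in S -> exists k e,
  [/\ (k : R) \is e.-homog, forall q, q \in S -> q != p -> vanish_at q k,
      ev k (rep p) != 0 & spans S -> (e + n <= #|` S|)%N].
Proof.
move=> pS.
have p0 : rep p \notin (0 : {vspace V})%VS by rewrite memv0 rep_neq0.
have pn : p \notin enum_fset (S `\ p)%fset.
  by have : p \notin (S `\ p)%fset by rewrite !inE eqxx.
have [k [e [h1 h2 h3 h4 h5]]] := separation_form p0 pn.
exists k, e; split=> //.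
  move=> q qS qp; apply: h4.
  by have : q \in (S `\ p)%fset by rewrite !inE qp.
move=> Ssp; move: h2; rewrite !add0v -big_fsetD1 //= Ssp.
rewrite (eqP (valP p)) dimvf /dim /= mul1n.
have -> : size (S `\ p)%fset = (#|` S|.-1)%N by rewrite (cardfsD1 p S) pS.
have : (0 < #|` S|)%N by rewrite cardfs_gt0; apply/fset0Pn; exists p.
by move: (#|` S|) => c; lia.
Qed.

Lemma double_at_ideal S p f (k : R) :
  (forall q, q \in S -> q != p -> vanish_at q k) ->
  ideal_square (vanish_at p) f -> double_ideal S (k ^+ 2 * f).
Proof.
move=> kS; apply: ideal_square_transport => g gp q qS v vq.
rewrite mevalM; have [E|qp] := eqVneq q p; first by rewrite gp ?mulr0 -?E.
by rewrite (kS q) ?mul0r.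
Qed.

(** Let J be the ideal of all E with E * f in the squared ideal of S.  For each
    p in S some power of X_i is congruent, modulo the forms vanishing at p, to
    an element e of J (to 0 if X_i vanishes at p).  The product over p of these
    differences X_i^D - e vanishes on S and has the shape X_i^N - E with E in
    J; the square of X_i^N = E + (X_i^N - E) then lies in J. *)
Lemma saturation S i f :
  (forall p, p \in S -> rep p 0 i != 0 -> double_at p f) ->
  exists m, double_ideal S ('X_i ^+ m * f).
Proof.
move=> fS.
have key (s : seq Pn) : {subset s <= S} -> exists N E,
    double_ideal S (E * f) /\ forall p, p \in s -> vanish_at p ('X_i ^+ N - E).
  elim: s => [|p s IH] sS.
    by exists 0%N, 0; split=> //; rewrite mul0r; apply: ideal_square0.
  have [|N [E [EJ Es]]] := IH; first by move=> q qs; apply: sS; rewrite inE qs orbT.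
  have pS : p \in S by apply: sS; rewrite inE eqxx.
  have [D [e [eJ ep]]] : exists D e, double_ideal S (e * f) /\
      vanish_at p ('X_i ^+ D - e).
    have [pi0|pi0] := eqVneq (rep p 0 i) 0.
      exists 1%N, 0; split; first by rewrite mul0r; apply: ideal_square0.
      rewrite subr0 expr1; apply: vanish_at_homog; first exact: homogX1.
      by rewrite mevalXU.
    have [u [d [hu u0 uf]]] := fS p pS pi0.
    have [k [e [hk kS k0 _]]] := separate_point pS.
    pose g := k ^+ 2 * u.
    have hg : g \is (e * 2 + d).-homog by apply: dhomogM => //; apply: dhomogMn.
    have g0 : ev g (rep p) != 0 by rewrite mevalM rmorphXn mulf_neq0 // expf_neq0.
    pose a := (rep p 0 i) ^+ (e * 2 + d) / ev g (rep p).
    exists (e * 2 + d)%N, (a%:MP * g); split.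
      rewrite -mulrA; apply: double_idealM; rewrite -mulrA.
      exact: (@double_at_ideal _ p).
    apply: (@vanish_at_homog _ _ _ _ (e * 2 + d)).
      rewrite mul_mpolyC; apply: rpredB; first exact: homogXn.
      exact: rpredZ.
    by rewrite mevalB mevalM mevalC rmorphXn /= mevalXU /a divfK // subrr.
  exists (N + D)%N, (E * 'X_i ^+ D + e * 'X_i ^+ N - E * e); split.
    have -> : (E * 'X_i ^+ D + e * 'X_i ^+ N - E * e) * f =
       'X_i ^+ D * (E * f) + ('X_i ^+ N - E) * (e * f) by ring.
    by apply: ideal_squareD; apply: double_idealM.
  have -> : 'X_i ^+ (N + D) - (E * 'X_i ^+ D + e * 'X_i ^+ N - E * e) =
      ('X_i ^+ N - E) * ('X_i ^+ D - e) by rewrite exprD; ring.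
  move=> q; rewrite inE => /orP[/eqP->|qs]; first exact: vanish_atM.
  by rewrite mulrC; apply/vanish_atM/Es.
have [N [E [EJ ES]]] := key _ (fun p => id).
exists (N * 2)%N; rewrite exprM.
have -> : 'X_i ^+ N ^+ 2 * f = (2 * 'X_i ^+ N - E) * (E * f)
    + f * (('X_i ^+ N - E) * ('X_i ^+ N - E)) by ring.
apply: ideal_squareD; first exact: double_idealM.
by apply: double_idealM; apply: ideal_square_mul => p pS; apply: ES.
Qed.

Section NormalForm.
Variables (p : Pn) (i : 'I_n.+1).
Hypothesis pi0 : rep p 0 i != 0.
Local Notation x := ('X_i : R).
Local Notation sq := (ideal_square (vanish_at p)).

Lemma linear_residue (l : R) : l \is 1.-homog -> exists c N,
  [/\ l = c%:MP * x + N, N \is 1.-homog, vanish_at p N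
    & ev l (rep p) = c * rep p 0 i].
Proof.
move=> hl; pose c := ev l (rep p) / rep p 0 i.
have hN : l - c%:MP * x \is 1.-homog.
  by rewrite mul_mpolyC; apply: rpredB => //; apply/rpredZ/homogX1.
exists c, (l - c%:MP * x); split=> //; first by rewrite addrCA subrr addr0.
  apply: vanish_at_homog hN _.
  by rewrite mevalB mevalM mevalC mevalXU /c divfK // subrr.
by rewrite /c divfK.
Qed.

(** With l = a x + A and m = b x + B, where A and B vanish at p, the only term
    of l * m not divisible by x is A * B, which lies in the squared ideal. *)
Lemma linear_product (l m : R) : l \is 1.-homog -> m \is 1.-homog ->
  exists k : R, k \is 1.-homog /\ sq (l * m - x * k).
Proof.
move=> hl hm.
have [a [A [El hA vA _]]] := linear_residue hl.
have [b [B [Em hB vB _]]] := linear_residue hm.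
exists (a%:MP * m + b%:MP * A); split.
  by rewrite !mul_mpolyC; apply: rpredD; apply: rpredZ.
have -> : l * m - x * (a%:MP * m + b%:MP * A) = A * B by rewrite El Em; ring.
exact: ideal_square_mul.
Qed.

(** This replaces the Taylor expansion at p: up to the squared ideal a form is
    determined by a linear form, which carries its value and its derivatives. *)
Lemma linear_normal_form D f : f \is D.+1.-homog ->
  exists l : R, l \is 1.-homog /\ sq (f - x ^+ D * l).
Proof.
move=> hf.
have nf_monomial k m : mdeg m = k.+1 -> exists l : R,
    l \is 1.-homog /\ sq ('X_[m] - x ^+ k * l).
  elim: k m => [|k IH] m hm.
    exists 'X_[m]; split; first by rewrite dhomogX; apply/eqP.
    by rewrite expr0 mul1r subrr; apply: ideal_square0.
  have [j mj] : exists j, (0 < m j)%N.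
    apply/existsP; apply: contraPT hm => /existsPn h; rewrite mdegE big1 // => j _.
    by apply/eqP; rewrite -leqn0 leqNgt.
  have Em : m = (U_(j) + (m - U_(j)))%MM.
    by apply/mnmP=> t; rewrite mnmDE mnmBE mnm1E; case: eqP mj => [<-|]; lia.
  have [|l [hl Il]] := IH (m - U_(j))%MM.
    by move: hm; rewrite {1}Em mdegD mdeg1 add1n => -[].
  have [l' [hl' Il']] := linear_product (homogX1 K j) hl.
  exists l'; split=> //.
  have -> : 'X_[m] - x ^+ k.+1 * l' = 'X_j * ('X_[m - U_(j)] - x ^+ k * l)
     + x ^+ k * ('X_j * l - x * l') by rewrite {1}Em mpolyXD exprS; ring.
  by apply: ideal_squareD; apply: square_vanish_atM.
pose P g := exists l : R, l \is 1.-homog /\ sq (g - x ^+ D * l).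
rewrite -/(P f) [f]mpolyE big_seq; apply: (big_ind P).
- by exists 0; rewrite rpred0 mulr0 subr0; split=> //; apply: ideal_square0.
- move=> g h [l [hl Il]] [l' [hl' Il']]; exists (l + l'); split; first exact: rpredD.
  have -> : g + h - x ^+ D * (l + l') = (g - x ^+ D * l) + (h - x ^+ D * l') by ring.
  exact: ideal_squareD.
- move=> m /(dhomogP _ _ _ hf) hm; have [l [hl Il]] := nf_monomial _ _ hm.
  exists (f@_m *: l); split; first exact: rpredZ.
  by rewrite -scalerAr -scalerBr -mul_mpolyC; apply: square_vanish_atM.
Qed.

(** Multiplication by E is onto on first-order germs at p because E is a unit
    there.  With normal forms e = a x + A of E and g = b x + B of G, the equation
    e l = x g is solved modulo squares by the expansion of x g / e to first order
    in A and B. *)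
Lemma linear_correction (E G : R) D m : E \is D.+1.-homog -> ev E (rep p) != 0 ->
  G \is (D.+2 + m).-homog ->
  exists l : R, l \is 1.-homog /\ sq (x ^+ m * (E * l) - G).
Proof.
move=> hE E0 hG.
have [e [he Ie]] := linear_normal_form hE.
have [g [hg Ig]] := linear_normal_form hG.
have [a [A [Ea hA vA ea]]] := linear_residue he.
have [b [B [Eb hB vB _]]] := linear_residue hg.
have a0 : a != 0.
  apply: contraNneq E0 => a0; rewrite a0 mul0r in ea.
  case: Ie => r [s [t [hs ht]]] /eqP; rewrite subr_eq => /eqP ->.
  rewrite mevalD mevalM ea mulr0 addr0 raddf_sum big1 //= => k _.
  by rewrite mevalM hs ?mul0r // mem_rep.
pose l := a^-1%:MP * g - (b / a ^+ 2)%:MP * A.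
exists l; split.
  by rewrite /l !mul_mpolyC; apply: rpredB; apply: rpredZ.
have el : e * l - x * g = A * (a^-1%:MP * B - (b / a ^+ 2)%:MP * A).
  (* The product a * a^-1 is isolated as z, to be replaced by 1 between two
     identities of commutative rings. *)
  have aV : a%:MP * a^-1%:MP = 1 :> R by rewrite -mpolyCM divff.
  rewrite /l Ea Eb; move: aV; set u := (a%:MP); set w := (a^-1%:MP) => uw.
  have -> : (b / a ^+ 2)%:MP = b%:MP * w ^+ 2 :> R.
    by rewrite -rmorphXn -rmorphM /= exprVn.
  pose z := u * w; have z1 : z = 1 by [].
  transitivity (z * (b%:MP * x ^+ 2 + x * B) - z * b%:MP * w * x * A + w * A * (b%:MP * x + B)
    - b%:MP * w ^+ 2 * A ^+ 2 - x * (b%:MP * x + B)); first by rewrite /z; ring.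
  by rewrite z1; ring.
have -> : x ^+ m * (E * l) - G = x ^+ m * l * (E - x ^+ D * e)
    + x ^+ (m + D) * (e * l - x * g) - (G - x ^+ (D.+1 + m) * g).
  by rewrite !exprD exprS; ring.
rewrite -[- (G - _)]mulN1r; apply: ideal_squareD; last exact: square_vanish_atM.
apply: ideal_squareD; apply: square_vanish_atM => //; rewrite el; apply: ideal_square_mul => //.
by apply: vanish_atB; apply: vanish_atM.
Qed.

End NormalForm.

End Local.

(** * Cocycles of twists of the structure sheaf split *)

Section Monomials.
Variables (K : fieldType) (n : nat).
Implicit Types (f g : {mpoly K[n]}) (m nu : 'X_{1..n}).

Definition mfilter (P : pred 'X_{1..n}) f : {mpoly K[n]} :=
  \sum_(m <- msupp f | P m) f@_m *: 'X_[m].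

Lemma mcoeff_mfilter P f m : (mfilter P f)@_m = if P m then f@_m else 0.
Proof.
rewrite raddf_sum /= -big_filter.
under eq_bigr do rewrite mcoeffZ mcoeffX.
have [mf|mf] := boolP (m \in msupp f); last first.
  rewrite (memN_msupp_eq0 mf) if_same big1_seq // => k.
  rewrite mem_filter => /andP[_ /andP[_ kf]].
  by case: eqP kf mf => [->|_]; rewrite ?mulr0 // => ->.
have [Pm|Pm] := boolP (P m).
  rewrite (bigD1_seq m) ?mem_filter ?Pm ?filter_uniq ?msupp_uniq //=.
  by rewrite eqxx mulr1 big1 ?addr0 // => k /negPf ->; rewrite mulr0.
rewrite big1_seq // => k; rewrite mem_filter => /andP[_ /andP[Pk _]].
by case: eqP Pk Pm => [->|_]; rewrite ?mulr0 // => ->.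
Qed.

Lemma monomial_factor f nu e : f \is (e + mdeg nu).-homog ->
  (forall m, m \in msupp f -> forall l, nu l <= m l)%N ->
  exists2 g, g \is e.-homog & f = g * 'X_[nu].
Proof.
move=> hf hnu; exists (\sum_(m <- msupp f) f@_m *: 'X_[m - nu]).
  rewrite big_seq; apply: rpred_sum => m mf; apply: rpredZ; rewrite dhomogX.
  apply/eqP; have := dhomogP _ _ _ hf m mf => /=.
  rewrite -{1}(@submK _ nu m); last exact/mnm_lepP/hnu.
  by rewrite mdegD => /addIn.
rewrite {1}[f]mpolyE mulr_suml; apply: eq_big_seq => m mf.
rewrite -scalerAl -mpolyXD submK //; exact/mnm_lepP/hnu.
Qed.

Lemma mpolyX_neq0 m : 'X_[m] != 0 :> {mpoly K[n]}.
Proof. by rewrite -msupp_eq0 msuppX. Qed.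

End Monomials.

Section Cech.
Variables (K : fieldType) (n : nat).
Local Notation R := {mpoly K[n.+1]}.
Implicit Types (I : R -> Prop) (f g : R) (i j k : 'I_n.+1).

Definition pair_index i j : {ffun 'I_2 -> 'I_n.+1} := [ffun k : 'I_2 => if k == 0 then i else j].
Definition triple_index i j k : {ffun 'I_3 -> 'I_n.+1} :=
  [ffun l : 'I_3 => if l == 0 then i else if l == 1 then j else k].

Lemma pair_indexE (s : {ffun 'I_2 -> 'I_n.+1}) : s = pair_index (s 0) (s 1).
Proof.
apply/ffunP=> k; rewrite ffunE; case: eqP => [->//|]; case: k => [[|[|k]] hk] //= h.
  by case: h; apply: val_inj.
by congr (s _); apply: val_inj.
Qed.

Lemma triple_indexE (s : {ffun 'I_3 -> 'I_n.+1}) : s = triple_index (s 0) (s 1) (s ord_max).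
Proof.
apply/ffunP=> k; rewrite ffunE; case: k => [[|[|[|k]]] hk] //=;
  by congr (s _); apply: val_inj.
Qed.

Lemma differential1E (c : cochain K n 1) i j k :
  differential c (triple_index i j k) = c (pair_index j k) - c (pair_index i k) + c (pair_index i j).
Proof.
rewrite ffunE !big_ord_recl big_ord0 /= addr0.
rewrite expr0 mul1r expr1 mulN1r sqrrN expr1n mul1r addrA.
have -> : face (triple_index i j k) ord0 = pair_index j k.
  by apply/ffunP=> l; rewrite !ffunE; case: l => [[|[|l]] hl].
have -> : face (triple_index i j k) (lift ord0 ord0) = pair_index i k.
  by apply/ffunP=> l; rewrite !ffunE; case: l => [[|[|l]] hl].
suff -> : face (triple_index i j k) (lift ord0 (lift ord0 ord0)) = pair_index i j by [].
by apply/ffunP=> l; rewrite !ffunE; case: l => [[|[|l]] hl].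
Qed.

Lemma differential0E (h : cochain K n 0) i j : differential h (pair_index i j) =
  h [ffun=> j] - h [ffun=> i].
Proof.
rewrite ffunE !big_ord_recl big_ord0 /= addr0 expr0 mul1r expr1 mulN1r.
have -> : face (pair_index i j) ord0 = [ffun=> j].
  by apply/ffunP=> l; rewrite !ffunE; case: l => [[|l] hl].
suff -> : face (pair_index i j) (lift ord0 ord0) = [ffun=> i] by [].
by apply/ffunP=> l; rewrite !ffunE; case: l => [[|l] hl].
Qed.

Lemma tofracX_neq0 (m : 'X_{1..n.+1}) : tofrac ('X_[m] : R) != 0.
Proof. by rewrite tofrac_eq0 mpolyX_neq0. Qed.

Lemma tofracXn_neq0 i m : tofrac ('X_i ^+ m : R) != 0.
Proof. by rewrite mpolyXn tofracX_neq0. Qed.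

(** Vanishing of the first cohomology of the twist by d.  After clearing the
    denominators by the N-th power of the product of all variables, the
    components C become forms of degree d + N (n + 1), so each of their monomials
    mu has an index kk mu with exponent at least N, that is, not a pole.  The
    contraction G i takes the coefficient of mu in C (pair_index (kk mu) i); no
    index other than i is a pole in it. *)
Lemma cocycle_splits I d (c : cochain K n 1) : is_cocycle I d c ->
  exists (m : nat) (G : 'I_n.+1 -> R), (forall i, G i \is (d + m).-homog) /\
   forall i j, c (pair_index i j) = tofrac (G j) / tofrac ('X_j ^+ m)
                          - tofrac (G i) / tofrac ('X_i ^+ m).
Proof.
move=> [hc dc].
have /fin_all_exists[m /fin_all_exists[f Hf]] := hc.
(* A factor 2 is needed for the pairs (i, i), whose denominator is X_i^2. *)
pose N := (2 * \max_s m s)%N.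
have mN s : (2 * m s <= N)%N by rewrite leq_mul2l /= leq_bigmax.
pose cst : 'X_{1..n.+1} := [multinom N | l < n.+1].
pose nu (s : {ffun 'I_2 -> 'I_n.+1}) : 'X_{1..n.+1} :=
  [multinom (N - m s * ((s ord0 == l) + (s ord_max == l)))%N | l < n.+1].
pose C s : R := f s * 'X_[nu s].
have denM s : (nu s + (U_(s ord0) + U_(s ord_max)) *+ m s)%MM = cst.
  apply/mnmP=> l; rewrite mnmDE mulmnE mnmDE !mnmE.
  by have := mN s; case: (s ord0 == l); case: (s ord_max == l) => /=; lia.
have den s : 'X_[nu s] * (\prod_k 'X_(s k)) ^+ m s = 'X_[cst] :> R.
  rewrite !big_ord_recl big_ord0 mulr1 -mpolyXD mpolyXn -mpolyXD -(denM s).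
  by have -> : lift ord0 ord0 = ord_max :> 'I_2 by apply: val_inj.
have cC s : tofrac (C s) = c s * tofrac 'X_[cst].
  have [_ _ ->] := Hf s; rewrite -(den s) /C !tofracM [X in _ = _ * X]mulrC [RHS]mulrA divfK //.
  by rewrite tofrac_eq0 expf_neq0 //; apply/prodf_neq0 => k _; apply: mpolyX_neq0.
have Chom s : C s \is (d + N * n.+1).-homog.
  have [_ hf _] := Hf s.
  have -> : (d + N * n.+1 = (d + m s * 2) + mdeg (nu s))%N.
    have /(congr1 mdeg) := denM s; rewrite mdegD mdegMn mdegD !mdeg1.
    have -> : mdeg cst = (N * n.+1)%N.
      by rewrite mdegE; under eq_bigr do rewrite mnmE; rewrite sum_nat_const card_ord mulnC.
    lia.
  by apply: dhomogM => //; rewrite dhomogX.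
have Ccoc i j k : C (pair_index j k) - C (pair_index i k) + C (pair_index i j) = 0.
  apply/eqP; rewrite -tofrac_eq0 tofracD tofracB !cC -mulrBl -mulrDl.
  by rewrite -differential1E dc ffunE mul0r.
have Clow i j mu : mu \in msupp (C (pair_index i j)) -> forall l, l != i -> l != j -> (N <= mu l)%N.
  rewrite /C (perm_mem (msuppMX _ _)) => /mapP[mu' _ ->] l li lj.
  by rewrite mnmDE mnmE !ffunE /= ![_ == l]eq_sym (negPf li) (negPf lj) muln0 subn0 leq_addr.
pose kk (mu : 'X_{1..n.+1}) := odflt ord0 [pick k | (N <= mu k)%N].
have kkP mu : mdeg mu = (d + N * n.+1)%N -> (N <= mu (kk mu))%N.
  move=> hmu; rewrite /kk; case: pickP => //= h.
  suff : (mdeg mu < N * n.+1)%N by lia.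
  have -> : (N * n.+1 = \sum_(l < n.+1) N)%N by rewrite sum_nat_const card_ord mulnC.
  rewrite mdegE !big_ord_recl; move/negbT: (h ord0); rewrite -ltnNge => h0.
  rewrite -addSn leq_add // leq_sum // => l _.
  by move/negbT: (h (lift ord0 l)); rewrite -ltnNge => /ltnW.
pose G i : R := \sum_k mfilter (fun mu => kk mu == k) (C (pair_index k i)).
have GE i mu : (G i)@_mu = (C (pair_index (kk mu) i))@_mu.
  rewrite /G raddf_sum /=; under eq_bigr do rewrite mcoeff_mfilter.
  rewrite (bigD1 (kk mu)) //= eqxx big1 ?addr0 // => k.
  by rewrite eq_sym => /negPf ->.
have Gs i mu : mu \in msupp (G i) -> mu \in msupp (C (pair_index (kk mu) i)).
  by rewrite !mcoeff_msupp GE.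
have Ghom i : G i \is (d + N * n.+1).-homog.
  by apply/dhomogP => mu /Gs; apply: dhomogP.
pose nu' i : 'X_{1..n.+1} := [multinom (if l == i then 0 else N)%N | l < n.+1].
have nu'E i : 'X_i ^+ N * 'X_[nu' i] = 'X_[cst] :> R.
  rewrite mpolyXn -mpolyXD; congr 'X_[_]; apply/mnmP => l.
  by rewrite mnmDE mulmnE !mnmE eq_sym; case: eqP => _; rewrite ?mul1n ?addn0 ?mul0n ?add0n.
have dnu i : mdeg (nu' i) = (N * n)%N.
  rewrite mdegE (bigD1 i) //= mnmE eqxx add0n.
  under eq_bigr => l /negPf li do rewrite mnmE li.
  by rewrite sum_nat_const mulnC cardC1 card_ord.
have /fin_all_exists2[G' hG' EG'] i : exists2 g, g \is (d + N).-homog & G i = g * 'X_[nu' i].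
  apply: monomial_factor; first by rewrite dnu -addnA -mulnS.
  move=> mu mui l; rewrite mnmE; case: eqP => // /eqP li.
  have [->|lk] := eqVneq l (kk mu); first exact/kkP/(dhomogP _ _ _ (Ghom i)).
  exact: (Clow _ _ _ (Gs _ _ mui)).
exists N, G'; split=> // i j.
have Gj l : tofrac (G' l) / tofrac ('X_l ^+ N) = tofrac (G l) / tofrac 'X_[cst].
  by rewrite EG' -(nu'E l) !tofracM -mulf_div divff ?mulr1 ?tofracX_neq0.
rewrite !Gj -mulrBl -tofracB.
have -> : G j - G i = C (pair_index i j).
  apply/mpolyP => mu; rewrite mcoeffB !GE.
  have /(congr1 (mcoeff mu)) := Ccoc (kk mu) i j.
  by rewrite mcoeffD mcoeffB mcoeff0 => /eqP; rewrite -addrA addr_eq0 => /eqP ->; rewrite opprD opprK.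
by rewrite cC mulfK // tofracX_neq0.
Qed.

End Cech.

(** * Vanishing of the first cohomology *)

Lemma cross_multiply (F : fieldType) (a b c x y z : F) :
  x != 0 -> y != 0 -> z != 0 -> a / y - b / x = c / z ->
  (a * x - b * y) * z = c * (x * y).
Proof.
move=> x0 y0 z0 E.
have -> : (a * x - b * y) * z = (a / y - b / x) * (x * y * z) by field; rewrite x0.
by rewrite E; field.
Qed.

Lemma common_denominator (F : fieldType) (g t x y : F) : x != 0 -> y != 0 ->
  g / x - t = y * (g - x * t) / (x * y).
Proof. by move=> x0 y0; field; rewrite x0 y0. Qed.

Section Vanishing.
Variables (K : fieldType) (n : nat).
Local Notation R := {mpoly K[n.+1]}.
Local Notation Pn := (proj_space K n).
Implicit Types (f g : R) (p q : Pn) (S : {fset Pn}) (d : nat).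

Lemma double_at0 p : double_at p (0 : R).
Proof. by apply: square_double_at; apply: ideal_square0. Qed.

Lemma double_atB p f g : double_at p f -> double_at p g -> double_at p (f - g).
Proof. by move=> hf hg; rewrite -[- g]mulN1r; apply/double_atD/double_atM. Qed.

Lemma spans_card_gt S : spans S -> (n < #|` S|)%N.
Proof.
move=> Ssp; have dim_le (s : seq Pn) : (\dim (\sum_(p <- s) val p)%VS <= size s)%N.
  elim: s => [|p s IH]; first by rewrite big_nil dimv0.
  rewrite big_cons /=; have [h _] := dimv_add_leqif (val p) (\sum_(q <- s) val q)%VS.
  by move: IH h; rewrite (eqP (valP p)); move: (\dim _) (\dim _) => a b; lia.
by have := dim_le S; rewrite Ssp dimvf /dim /= mul1n.
Qed.

Lemma double_at_separated S p q (k f : R) : q \in S -> q != p ->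
  (forall q, q \in S -> q != p -> vanish_at q k) -> double_at q (k ^+ 2 * f).
Proof.
move=> qS qp kS; rewrite mulrC; apply/double_atM/square_double_at.
by rewrite expr2; apply: ideal_square_mul; apply: kS.
Qed.

Lemma section_double_at S d i j (m : nat) (f g : R) p : p \in S ->
  rep p 0 i != 0 -> rep p 0 j != 0 ->
  is_section (double_ideal S) d (pair_index i j)
    (tofrac g / tofrac ('X_j ^+ m) - tofrac f / tofrac ('X_i ^+ m)) ->
  double_at p (g * 'X_i ^+ m - f * 'X_j ^+ m).
Proof.
move=> pS pi pj [M [h [hS _ E]]].
have {}E : (g * 'X_i ^+ m - f * 'X_j ^+ m) * ('X_i * 'X_j) ^+ M
         = h * ('X_i ^+ m * 'X_j ^+ m).
  have prodE : \prod_k 'X_(pair_index i j k) = 'X_i * 'X_j :> R.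
    by rewrite !big_ord_recl big_ord0 mulr1 !ffunE.
  move: E; rewrite prodE => /cross_multiply E; apply/eqP; rewrite -tofrac_eq.
  rewrite !(tofracM, tofracB); apply/eqP; apply: E.
  - exact: tofracXn_neq0.
  - exact: tofracXn_neq0.
  - by rewrite tofrac_eq0 expf_neq0 // mulf_neq0 ?mpolyX_neq0.
apply: (@double_at_cancel _ _ _ (('X_i * 'X_j) ^+ M) _ (2 * M)).
- by apply: dhomogMn; rewrite -[2%N]/(1 + 1)%N; apply: dhomogM; apply: homogX1.
- by rewrite rmorphXn rmorphM /= !mevalXU expf_neq0 // mulf_neq0.
by rewrite mulrC E mulrC; apply/double_atM/(double_ideal_at pS).
Qed.

(** For each p of S a form F of degree d is found that agrees to first order at
    p with the local section G i / X_i^m and vanishes doubly on the rest of S.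
    The germ at p does not depend on i since the cocycle lies in the squared
    ideal, so one index i0 with X_i0 nonzero at p suffices to choose F.  The
    sum of these F corrects all the local sections at once. *)
Theorem h1_vanishing S d : spans S -> (2 * #|` S| < 2 * n + d)%N ->
  ~ h_gt (double_ideal S) d 1 0.
Proof.
move=> Ssp hd [c [hc hcob]].
suff : is_coboundary (double_ideal S) d (c ord0).
  move=> h; have /(hcob (fun=> 1))/(_ ord0)/eqP : is_coboundary (double_ideal S) d
      [ffun s => \sum_(i < 1) tofrac (1 : K)%:MP * c i s].
    have -> // : [ffun s => \sum_(i < 1) tofrac (1 : K)%:MP * c i s] = c ord0.
    by apply/ffunP => s; rewrite ffunE big_ord1 rmorph1 mul1r.
  by rewrite oner_eq0.
move: (c ord0) (hc ord0) => {hc hcob} {}c cc.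
have [m [G [hG cG]]] := cocycle_splits cc.
have [D dD] : exists D, d = D.+2.
  exists (d - 2)%N; move: (spans_card_gt Ssp) hd; move: (#|` S|)%N => x; lia.
have correction (p : S) : exists F : R, [/\ F \is d.-homog,
    forall q, q \in S -> q != val p -> double_at q F
  & forall i, rep (val p) 0 i != 0 -> double_at (val p) (G i - 'X_i ^+ m * F)].
  have [i0 pi0] := rep_coord (val p).
  have [k [e [hk kS k0 /(_ Ssp) he]]] := separate_point (valP p).
  (* The power of X_i0 only adjusts the degree; it does not vanish at p. *)
  pose E : R := k ^+ 2 * 'X_i0 ^+ (D.+1 - e * 2).
  have hE : E \is D.+1.-homog.
    have -> : D.+1 = (e * 2 + (D.+1 - e * 2))%N.
      by move: he hd; move: (#|` S|)%N => x; lia.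
    apply: dhomogM; [exact: dhomogMn | exact: homogXn].
  have E0 : ev E (rep (val p)) != 0.
    by rewrite mevalM !rmorphXn /= mevalXU mulf_neq0 ?expf_neq0.
  have hG0 : G i0 \is (D.+2 + m).-homog by rewrite -dD.
  have [l [hl El]] := linear_correction pi0 hE E0 hG0.
  exists (E * l); split.
  - have -> : d = (D.+1 + 1)%N by rewrite dD addn1.
    exact: dhomogM.
  - by move=> q qS qp; rewrite -mulrA; apply: (double_at_separated _ qS qp kS).
  move=> i pi; apply: (double_at_cancel (homogXn K i0 m)).
    by rewrite rmorphXn /= mevalXU expf_neq0.
  have -> : 'X_i0 ^+ m * (G i - 'X_i ^+ m * (E * l)) =
     (G i * 'X_i0 ^+ m - G i0 * 'X_i ^+ m) - 'X_i ^+ m * ('X_i0 ^+ m * (E * l) - G i0).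
    by ring.
  apply: double_atB; last exact/double_atM/square_double_at.
  by apply: (section_double_at (valP p) pi0 pi (d := d)); rewrite -cG; apply: cc.1.
have /fin_all_exists[F hF] := correction.
pose Ft := \sum_p F p.
have sat i : exists M, double_ideal S ('X_i ^+ M * (G i - 'X_i ^+ m * Ft)).
  apply: saturation => p pS pi; pose p' : S := [` pS]%fset.
  have [_ _ /(_ i pi) h] := hF p'.
  have -> : G i - 'X_i ^+ m * Ft =
     (G i - 'X_i ^+ m * F p') - 'X_i ^+ m * \sum_(q | q != p') F q.
    by rewrite /Ft (bigD1 p') //= mulrDr opprD addrA.
  apply: double_atB => //; apply: double_atM.
  apply: (big_ind (double_at p)); [exact: double_at0 | exact: double_atD |].
  move=> q qp; have [_ + _] := hF q; apply=> //.
  by apply: contra qp => /eqP e; apply/eqP/val_inj.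
exists [ffun s : {ffun 'I_1 -> 'I_n.+1} => tofrac (G (s ord0)) / tofrac ('X_(s ord0) ^+ m) - tofrac Ft].
  move=> s; rewrite ffunE; set i := s ord0; have [M hM] := sat i.
  exists (m + M)%N, ('X_i ^+ M * (G i - 'X_i ^+ m * Ft)); split=> //.
    have -> : (d + (m + M) * 1 = M + (m + d))%N by lia.
    apply: dhomogM; first exact: homogXn.
    have hGi : G i \is (m + d).-homog by rewrite [(m + d)%N]addnC; apply: hG.
    apply: rpredB; first exact: hGi.
    apply: dhomogM; first exact: homogXn.
    by apply: rpred_sum => p _; have [] := hF p.
  rewrite big_ord1 -/i exprD !(tofracM, tofracB).
  by apply: common_denominator; apply: tofracXn_neq0.
apply/ffunP => s; rewrite (pair_indexE s) differential0E !ffunE cG /=.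
by rewrite opprB addrA subrK.
Qed.

End Vanishing.

(** * Restriction of forms to parametrized curves *)

Section Substitution.
Variables (K : fieldType) (n : nat).
Local Notation R := {mpoly K[n]}.
Implicit Types (f g : R) (param : 'I_n -> {poly K}).

Definition curve_subst param f : {poly K} := mmap (@polyC K) param f.

Lemma curve_subst_horner param f t : (curve_subst param f).[t] = f.@[fun j => (param j).[t]].
Proof.
rewrite mevalE /curve_subst /mmap horner_sum; apply: eq_bigr => m _.
rewrite hornerM hornerC horner_prod; congr (_ * _); apply: eq_bigr => i _.
by rewrite horner_exp.
Qed.

Lemma curve_substM param f g : curve_subst param (f * g) = curve_subst param f * curve_subst param g.
Proof. exact: rmorphM. Qed.

Lemma size_curve_subst param f d : (forall j, size (param j) <= 2)%N -> f \is d.-homog ->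
  (size (curve_subst param f) <= d.+1)%N.
Proof.
move=> hg hf; rewrite /curve_subst /mmap big_seq.
apply: (leq_trans (size_sum _ _ _)); apply/bigmax_leqP_seq => m _ mf.
rewrite mul_polyC; apply: (leq_trans (size_scale_leq _ _)).
have /= <- := dhomogP _ _ _ hf m mf; rewrite mdegE.
rewrite /mmap1; apply: (big_ind2 (fun (p : {poly K}) k => size p <= k.+1)%N).
- by rewrite size_poly1.
- move=> p k q l hp hq; apply: (leq_trans (size_polyMleq _ _)); lia.
- move=> i _; apply: (leq_trans (size_poly_exp_leq _ _)); have := hg i.
  case: (size _) => [|[|[|k]]] //=; lia.
Qed.

End Substitution.

Section InfiniteField.
Variables (K : fieldType).
Hypothesis charK : [pchar K] =i pred0.

Lemma natr_char0_inj : injective (fun k : nat => k%:R : K).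
Proof.
have /pcharf0P h := charK.
have aux i j : (i <= j)%N -> i%:R = j%:R :> K -> i = j.
  move=> ij /eqP; rewrite eq_sym -subr_eq0 -natrB // h subn_eq0 => ji.
  by apply/eqP; rewrite eqn_leq ij.
move=> i j /= e; case: (leqP i j) => [/aux->//|/ltnW/aux h']; by rewrite h'.
Qed.

Lemma poly_eq0_nat (p : {poly K}) : (forall k : nat, p.[k.+1%:R] = 0) -> p = 0.
Proof.
move=> h; apply: (@roots_geq_poly_eq0 _ p [seq k.+1%:R : K | k <- iota 0 (size p)]).
- by apply/allP => _ /mapP[k _ ->]; apply/rootP/h.
- by rewrite map_inj_uniq ?iota_uniq // => i j /natr_char0_inj[].
- by rewrite size_map size_iota.
Qed.

(** Uniqueness of base B expansions, for the Kronecker substitution. *)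
Lemma base_expansion_inj (B n : nat) (a b : 'I_n -> nat) :
  (forall i, a i < B)%N -> (forall i, b i < B)%N ->
  (\sum_i a i * B ^ i = \sum_i b i * B ^ i)%N -> a =1 b.
Proof.
elim: n a b => [|n IH] a b ha hb; first by move=> _ [].
rewrite !big_ord_recl /= !expn0 !muln1.
have shift (c : 'I_n.+1 -> nat) : (\sum_(i < n) c (lift ord0 i) * B ^ bump 0 i
    = (\sum_(i < n) c (lift ord0 i) * B ^ i) * B)%N.
  by rewrite big_distrl /=; apply: eq_bigr => i _; rewrite /bump /= expnS; lia.
rewrite !shift => E.
have E0 : a ord0 = b ord0.
  by have /(congr1 (modn^~ B)) := E; rewrite /= ![(_ + _ * B)%N]addnC !modnMDl !modn_small.
have B0 : (0 < B)%N by apply: leq_ltn_trans (ha ord0).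
have /IH h : (\sum_(i < n) a (lift ord0 i) * B ^ i = \sum_(i < n) b (lift ord0 i) * B ^ i)%N.
  by move/eqP: E; rewrite E0 eqn_add2l eqn_pmul2r // => /eqP.
move=> i; case: (unliftP ord0 i) => [j ->|->//]; exact: h.
Qed.

(** Kronecker substitution X_j = T^(B^j) with B above all exponents keeps
    distinct monomials distinct, and a nonzero univariate polynomial has a
    nonzero value at some natural number. *)
Lemma mpoly_nonvanishing n (f : {mpoly K[n]}) : f != 0 ->
  exists u : 'rV[K]_n, f.@[fun i => u 0 i] != 0.
Proof.
move=> f0; pose B := msize f; pose param (j : 'I_n) : {poly K} := 'X^(B ^ j).
pose kap (m : 'X_{1..n}) := (\sum_(j < n) m j * B ^ j)%N.
have lt m j : m \in msupp f -> (m j < B)%N.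
  move=> /msize_mdeg_lt; apply: leq_ltn_trans; rewrite mdegE (bigD1 j) //=; exact: leq_addr.
have substE : curve_subst param f = \sum_(m <- msupp f) f@_m *: 'X^(kap m).
  rewrite /curve_subst /mmap; apply: eq_bigr => m _; rewrite mul_polyC; congr (_ *: _).
  rewrite /mmap1 /kap; apply: (big_ind2 (fun (p : {poly K}) k => p = 'X^k)) => //.
    by move=> p k q l -> ->; rewrite exprD.
  by move=> j _; rewrite /param -exprM mulnC.
have : curve_subst param f != 0.
  have m0 := mlead_supp f0; apply: contraTneq (m0) => s0.
  have := congr1 (fun p : {poly K} => p`_(kap (mlead f))) s0.
  rewrite substE coef0 coef_sum (bigD1_seq (mlead f)) ?msupp_uniq //= big1_seq.
    by rewrite addr0 coefZ coefXn eqxx mulr1 => /eqP; rewrite mcoeff_eq0.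
  move=> m /andP[mm ms]; rewrite coefZ coefXn; case: eqP => [e|]; last by rewrite mulr0.
  suff E : m = mlead f by rewrite E eqxx in mm.
  by apply/mnmP; apply: (@base_expansion_inj B) (esym e) => j; apply: lt.
case: (boolP [exists k : 'I_(size (curve_subst param f)).+1, (curve_subst param f).[k.+1%:R] != 0]).
  case/existsP => k; rewrite curve_subst_horner => h _.
  exists (\row_j (param j).[k.+1%:R]); move: h; congr (_ != 0).
  by apply: meval_eq => j; rewrite mxE.
move/existsPn => h; case/eqP.
apply: (@roots_geq_poly_eq0 _ _ [seq k.+1%:R : K | k <- iota 0 (size (curve_subst param f))]).
- apply/allP => y /mapP[k]; rewrite mem_iota add0n => /andP[_ hk] ->; apply/rootP/eqP.
  by have := h (Ordinal (ltnW hk : (k < _.+1)%N)); rewrite negbK.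
- by rewrite map_inj_uniq ?iota_uniq // => i j /natr_char0_inj[].
- by rewrite size_map size_iota.
Qed.

End InfiniteField.

Section Singular.
Variables (K : fieldType) (n : nat).
Local Notation R := {mpoly K[n.+1]}.
Local Notation V := 'rV[K]_n.+1.
Local Notation Pn := (proj_space K n).
Implicit Types (f g F : R) (p q : Pn) (S : {fset Pn}) (v w : V) (d : nat).

Lemma curve_subst_double p F (param : 'I_n.+1 -> {poly K}) t : double_at p F ->
  \row_j (param j).[t] \in val p -> \row_j (param j).[t] != 0 ->
  ('X - t%:P) ^+ 2 %| curve_subst param F.
Proof.
move=> [u [e [hu u0 [m [a [b [ha hb E]]]]]]] gp g0.
have evE g : (curve_subst param g).[t] = ev g (\row_j (param j).[t]).
  by rewrite curve_subst_horner; apply: meval_eq => j; rewrite mxE.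
have ut : ~~ root (curve_subst param u) t.
  rewrite /root evE; have [c cE] := lineP _ _ gp.
  rewrite cE (homog_evZ _ _ hu) mulf_neq0 // expf_neq0 //.
  by apply: contraNneq g0 => c0; rewrite cE c0 scale0r.
have dvd g : vanish_at p g -> 'X - t%:P %| curve_subst param g.
  by move=> hg; rewrite dvdp_XsubCl; apply/rootP; rewrite evE hg.
rewrite -(@Gauss_dvdpr _ _ (curve_subst param u)); last first.
  by rewrite coprimep_expl // coprimep_sym coprimep_XsubC.
rewrite -curve_substM E /curve_subst rmorph_sum /=; apply: (big_ind (dvdp _)).
- exact: dvdp0.
- by move=> y z; apply: dvdp_add.
- by move=> i _; rewrite rmorphM expr2; apply: dvdp_mul; apply: dvd.
Qed.

Lemma double_at_vanish p F d : F \is d.-homog -> double_at p F -> vanish_at p F.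
Proof.
move=> hF [u [e [hu u0 [m [a [b [ha hb E]]]]]]]; apply: (vanish_at_homog hF).
apply/eqP; have : ev (u * F) (rep p) == 0.
  rewrite E raddf_sum /= big1 // => k _.
  by rewrite mevalM ha ?mul0r // mem_rep.
by rewrite mevalM mulf_eq0 (negPf u0).
Qed.

Definition affine_line w v (j : 'I_n.+1) : {poly K} := (w 0 j)%:P + v 0 j *: 'X.

Lemma affine_line_row w v t : \row_j (affine_line w v j).[t] = w + t *: v.
Proof. by apply/rowP => j; rewrite !mxE hornerD hornerC hornerZ hornerX mulrC. Qed.

Lemma curve_subst_line w v F t : (curve_subst (affine_line w v) F).[t] = ev F (w + t *: v).
Proof. by rewrite curve_subst_horner -affine_line_row; apply: meval_eq => j; rewrite [RHS]mxE. Qed.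

Lemma size_affine_line w v j : (size (affine_line w v j) <= 2)%N.
Proof.
rewrite (leq_trans (size_polyD _ _)) // geq_max (leq_trans (size_polyC_leq1 _)) //=.
by rewrite (leq_trans (size_scale_leq _ _)) // size_polyX.
Qed.

Hypothesis charK : [pchar K] =i pred0.

(** The restriction of F to v + t w is divisible by t^2; homogeneity turns this
    double zero at t = 0 into a drop by two of the degree of the restriction to
    w + t v, whose coefficients are the same in reverse order. *)
Lemma size_line_through_double p F d v w : F \is d.-homog -> double_at p F ->
  v \in val p -> v != 0 -> (size (curve_subst (affine_line w v) F) <= d.-1)%N.
Proof.
move=> hF pF vp v0; set tau := curve_subst _ F; pose sig := curve_subst (affine_line v w) F.
have sz : (size sig <= d.+1)%N by apply: size_curve_subst hF => j; apply: size_affine_line.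
have : ('X - 0%:P) ^+ 2 %| sig.
  by apply: (curve_subst_double pF); rewrite affine_line_row scale0r addr0.
rewrite subr0 => /dvdpP[r sigE].
have sig01 k : (k < 2)%N -> sig`_k = 0 by rewrite sigE coefMXn => ->.
pose q := \poly_(k < d.+1) sig`_(d - k).
have -> : tau = q.
  apply/eqP; rewrite -subr_eq0; apply/eqP/(poly_eq0_nat charK) => k.
  set a : K := k.+1%:R; have a0 : a != 0 by have /pcharf0P -> := charK.
  rewrite hornerD hornerN curve_subst_line.
  have -> : w + a *: v = a *: (v + a^-1 *: w).
    by rewrite scalerDr scalerA divff // scale1r addrC.
  rewrite (homog_evZ _ _ hF) -curve_subst_line -/sig (horner_coef_wide _ sz) horner_poly.
  rewrite mulr_sumr (reindex_inj rev_ord_inj) /=; apply/eqP; rewrite subr_eq0; apply/eqP.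
  apply: eq_bigr => j _; rewrite subSS mulrCA; congr (_ * _).
  rewrite exprVn -{1}(subnK (ltn_ord j : (j <= d)%N)) addnC exprD mulfK //.
  by rewrite expf_neq0.
apply/leq_sizeP => j hj; rewrite coef_poly; case: ltnP => // jd.
by apply: sig01; lia.
Qed.

(** The sections over all charts are one fraction; comparing its denominators, a
    power of X_0 and a power of another variable, shows that it is a form. *)
Lemma h0_gives_form S d : (0 < n)%N -> h_gt (double_ideal S) d 0 0 ->
  exists F : R, [/\ F != 0, F \is d.-homog & forall p, p \in S -> double_at p F].
Proof.
move=> n0 [c [hc hcob]]; have [cc dc] := hc ord0.
pose cst i : {ffun 'I_1 -> 'I_n.+1} := [ffun=> i].
have same i j : c ord0 (cst j) = c ord0 (cst i).
  by move/ffunP: dc => /(_ (pair_index i j)); rewrite differential0E ffunE => /eqP; rewrite subr_eq0 => /eqP.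
have cE (s : {ffun 'I_1 -> 'I_n.+1}) : s = cst (s ord0).
  by apply/ffunP => k; rewrite ffunE ord1.
have sec i : exists m f, [/\ double_ideal S f, f \is (d + m).-homog
    & c ord0 (cst ord0) = tofrac f / tofrac ('X_i ^+ m)].
  have [m [f [h1 h2 h3]]] := cc (cst i); exists m, f.
  by rewrite (same i) h3 big_ord1 ffunE -[m in (d + m)%N]muln1.
have [m [f [fS hf fE]]] := sec ord0.
have [m' [f' [_ _ fE']]] := sec (ord_max).
have Eq : f * 'X_ord_max ^+ m' = f' * 'X_ord0 ^+ m.
  apply/eqP; rewrite -tofrac_eq !tofracM; apply/eqP.
  by apply/eqP; rewrite -eqr_div ?tofracXn_neq0 // -fE -fE'.
have [F hF EF] : exists2 F : R, F \is d.-homog & f = F * 'X_[U_(ord0) *+ m].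
  apply: monomial_factor; first by rewrite mdegMn mdeg1 mul1n.
  move=> mu hmu l; rewrite mulmnE mnm1E; case: eqP => [<-|]; last by rewrite mul0n.
  have : (U_(ord_max) *+ m' + mu)%MM \in msupp (f * 'X_[U_(ord_max) *+ m']).
    by rewrite mcoeff_msupp mcoeffMX -mcoeff_msupp.
  rewrite -mpolyXn Eq mpolyXn (perm_mem (msuppMX _ _)) => /mapP[mu' _].
  move/(congr1 (fun k : 'X_{1..n.+1} => k ord0)); rewrite !mnmDE !mulmnE !mnm1E eqxx mul1n.
  have -> : (ord_max == ord0 :> 'I_n.+1) = false by apply/negbTE; rewrite -val_eqE /= -lt0n.
  by rewrite mul0n add0n => ->; apply: leq_addr.
have cF : c ord0 (cst ord0) = tofrac F.
  by rewrite fE EF -mpolyXn tofracM mulfK ?tofracXn_neq0.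
exists F; split=> //.
  apply: contraNneq (oner_neq0 K) => F0; apply/eqP.
  apply: (hcob (fun=> 1) _ ord0); apply/ffunP => s; rewrite !ffunE big_ord1.
  by rewrite (cE s) (same ord0) cF F0 tofrac0 mulr0.
move=> p pS; have [i pi] := rep_coord p.
have [k [g [gS _ gE]]] := sec i.
apply: (double_at_cancel (homogXn K i k)); first by rewrite rmorphXn /= mevalXU expf_neq0.
apply: (double_ideal_at pS).
suff -> : 'X_i ^+ k * F = g by [].
apply/eqP; rewrite -tofrac_eq tofracM mulrC -cF gE divfK //; exact: tofracXn_neq0.
Qed.

End Singular.

(** * Singular quadrics, binary forms and plane cubics *)

Section SmallCases.
Variables (K : fieldType).
Hypothesis charK : [pchar K] =i pred0.

(** On each line in the direction of a point of S the quadric has degree at most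
    0, so it is invariant under translation by the span of S, which is all. *)
Lemma quadric_singular_zero n (S : {fset proj_space K n}) (F : {mpoly K[n.+1]}) :
  spans S -> F \is 2.-homog -> (forall p, p \in S -> double_at p F) -> F = 0.
Proof.
move=> Ssp hF dF; apply/eqP; apply: contraT => /(mpoly_nonvanishing charK)[u].
suff trans (s : seq (proj_space K n)) : {subset s <= S} ->
    forall v, v \in (\sum_(p <- s) val p)%VS -> forall w, ev F (w + v) = ev F w.
  have : u \in (\sum_(p <- S) val p)%VS by rewrite Ssp memvf.
  move/(trans S (fun _ => id))/(_ 0); rewrite add0r => ->.
  by rewrite -(scale0r u) (homog_evZ _ _ hF) expr0n mul0r eqxx.
elim: s => [|p s IH] sS v.
  by rewrite big_nil memv0 => /eqP -> w; rewrite addr0.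
rewrite big_cons => /memv_addP[v1 v1p [v2 v2s ->]] w.
rewrite addrA IH //; last by move=> q qs; apply: sS; rewrite inE qs orbT.
have [->|v10] := eqVneq v1 0; first by rewrite addr0.
have := size_line_through_double charK w hF (dF p (sS p (mem_head _ _))) v1p v10.
move/size1_polyC => E; have := curve_subst_line w v1 F 1; have := curve_subst_line w v1 F 0.
by rewrite E !hornerC scale0r addr0 scale1r => -> ->.
Qed.

Lemma prod_sqr_XsubC_dvdp (rs : seq K) (t : {poly K}) : uniq rs ->
  (forall a, a \in rs -> ('X - a%:P) ^+ 2 %| t) ->
  \prod_(a <- rs) ('X - a%:P) ^+ 2 %| t.
Proof.
elim: rs => [|a rs IH] /=; first by rewrite big_nil dvd1p.
move=> /andP[ar ur] h; rewrite big_cons Gauss_dvdp; last first.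
  apply: coprimep_expl; rewrite coprimep_sym coprimep_XsubC /root horner_prod.
  rewrite prodf_seq_neq0; apply/allP => b br /=.
  rewrite horner_exp hornerXsubC expf_neq0 // subr_eq0.
  by apply: contraNneq ar => ->.
by rewrite h ?mem_head // IH // => b br; apply: h; rewrite inE br orbT.
Qed.

(** Choose u outside the zeros of F.  On the line through u in the direction of
    p0 the form has degree at most d - 2, and every other point of S gives a
    double root. *)
Lemma binary_singular_bound (S : {fset proj_space K 1}) d (F : {mpoly K[2]}) :
  spans S -> F != 0 -> F \is d.-homog -> (forall p, p \in S -> double_at p F) ->
  (2 * #|` S| <= d)%N.
Proof.
move=> Ssp F0 hF dF; have [u u0] := mpoly_nonvanishing charK F0.
have /fset0Pn[p0 p0S] : S != fset0 by rewrite -cardfs_gt0; apply: ltnW (spans_card_gt Ssp).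
pose tau := curve_subst (affine_line u (rep p0)) F.
have szt : (size tau <= d.-1)%N.
  apply: (size_line_through_double charK _ hF (dF _ p0S)); last exact: rep_neq0.
  exact: mem_rep.
have t0 : tau != 0.
  apply: contraNneq u0 => t0; have := curve_subst_line u (rep p0) F 0.
  by rewrite -/tau t0 horner0 scale0r addr0 => <-.
have up0 : u \notin val p0.
  by apply: contraNN u0 => up; rewrite (double_at_vanish hF (dF _ p0S)).
have w0 t : u + t *: rep p0 != 0.
  apply: contraNneq up0 => /eqP; rewrite addr_eq0 => /eqP ->.
  by rewrite memvN memvZ // mem_rep.
have full : (<[u]> + val p0 = fullv)%VS.
  apply/eqP; rewrite eqEdim subvf dimvf /dim /= mul1n.
  have [+ +] := dimv_leqif_eq (addvSr <[u]> (val p0)).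
  rewrite (eqP (valP p0)) leq_eqVlt => /orP[/eqP <-|//]; rewrite eqxx => /esym/eqP E.
  by case/negP: up0; rewrite E; apply: (subvP (addvSl _ _)); apply: memv_line.
have dir (p : (S `\ p0)%fset) : exists t, u + t *: rep p0 \in val (val p).
  have /memv_addP[u' /vlineP[a ->] [v' /lineP[b ->] E]] : rep (val p) \in (<[u]> + val p0)%VS.
    by rewrite full memvf.
  have a0 : a != 0.
    have := fsvalP p; rewrite !inE => /andP[+ _]; apply: contraNneq => a0.
    apply/eqP/esym/rep_in_eq; rewrite E a0 scale0r add0r memvZ // mem_rep //.
  exists (a^-1 * b); have -> : u + (a^-1 * b) *: rep p0 = a^-1 *: rep (val p).
    by rewrite E scalerDr !scalerA mulVf // scale1r.
  by rewrite memvZ // mem_rep.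
have /fin_all_exists[t ht] := dir.
have tinj : injective t.
  move=> p q e; apply/val_inj/val_inj; have := ht q; rewrite -e => hq.
  by rewrite (mem_line_eq (ht p) (w0 _)) (mem_line_eq hq (w0 _)).
have := prod_sqr_XsubC_dvdp (rs := [seq t p | p <- enum {: (S `\ p0)%fset}]) (t := tau).
rewrite map_inj_uniq // enum_uniq => /(_ isT) h.
have {h} /dvdp_leq : \prod_(a <- [seq t p | p <- enum {: (S `\ p0)%fset}]) ('X - a%:P) ^+ 2 %| tau.
  apply: h => _ /mapP[p _ ->].
  have := fsvalP p; rewrite !inE => /andP[_ pS].
  apply: (curve_subst_double (dF _ pS)); rewrite affine_line_row; first exact: ht.
  exact: w0.
move/(_ t0); rewrite prodrXl => h; move: (leq_trans h szt) => {h}.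
set P := \prod_(_ <- _) _ => h.
have : (0 < size (P ^+ 2))%N.
  by rewrite size_poly_gt0 expf_neq0 // monic_neq0 // monic_prod_XsubC.
have := size_exp P 2; move: h; rewrite {2}/P size_prod_XsubC size_map -cardE -cardfE /=.
rewrite (cardfsD1 p0 S) p0S; move: (#|` _ |) (size _) => x y; lia.
Qed.

(** A function affine in each variable is determined by its values at the
    vertices of the cube, and homogeneity of degree 3 kills all of them but
    G 1 1 1: at a vertex with k < 3 ones the value g satisfies 2^k g = 2^3 g. *)
Lemma multiaffine_cubic (G : K -> K -> K -> K) :
  (forall t a b c, G (t * a) (t * b) (t * c) = t ^+ 3 * G a b c) ->
  (forall a b c, G a b c = G 0 b c + a * (G 1 b c - G 0 b c)) ->
  (forall a b c, G a b c = G a 0 c + b * (G a 1 c - G a 0 c)) ->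
  (forall a b c, G a b c = G a b 0 + c * (G a b 1 - G a b 0)) ->
  forall a b c, G a b c = a * b * c * G 1 1 1.
Proof.
have two0 : 2%:R != 0 :> K by have /pcharf0P -> := charK.
have six0 : 6%:R != 0 :> K by have /pcharf0P -> := charK.
move=> hom G1 G2 G3.
have cancel k (x : K) : k != 0 -> k * x = 0 -> x = 0.
  by move=> k0 /eqP; rewrite mulf_eq0 (negPf k0) => /eqP.
have G0 : G 0 0 0 = 0.
  by have := hom 0 0 0 0; rewrite !mul0r expr0n /= mul0r.
have A1 : G 1 0 0 = 0.
  apply: (cancel 6%:R) => //; have := hom 2 1 0 0.
  rewrite !mulr0 mulr1 (G1 2) G0 => e; move: (G 1 0 0) e => x e.
  transitivity (2 ^+ 3 * x - (0 + 2 * (x - 0))); first by ring.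
  by rewrite -e subrr.
have A2 : G 0 1 0 = 0.
  apply: (cancel 6%:R) => //; have := hom 2 0 1 0.
  rewrite !mulr0 mulr1 (G2 0 2) G0 => e; move: (G 0 1 0) e => x e.
  transitivity (2 ^+ 3 * x - (0 + 2 * (x - 0))); first by ring.
  by rewrite -e subrr.
have A3 : G 0 0 1 = 0.
  apply: (cancel 6%:R) => //; have := hom 2 0 0 1.
  rewrite !mulr0 mulr1 (G3 0 0 2) G0 => e; move: (G 0 0 1) e => x e.
  transitivity (2 ^+ 3 * x - (0 + 2 * (x - 0))); first by ring.
  by rewrite -e subrr.
have four0 : 2%:R ^+ 2 != 0 :> K by rewrite expf_neq0.
have B1 : G 0 1 1 = 0.
  apply: (cancel (2%:R ^+ 2)) => //; have := hom 2 0 1 1.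
  rewrite !mulr0 !mulr1 (G2 0 2 2) !(G3 _ _ 2) G0 A2 A3 => e; move: (G 0 1 1) e => x e.
  transitivity (2 ^+ 3 * x - (0 + 2 * (0 - 0) + 2 * (0 + 2 * (x - 0) - (0 + 2 * (0 - 0))))); first by ring.
  by rewrite -e subrr.
have B2 : G 1 0 1 = 0.
  apply: (cancel (2%:R ^+ 2)) => //; have := hom 2 1 0 1.
  rewrite !mulr0 !mulr1 (G1 2 0 2) !(G3 _ _ 2) G0 A1 A3 => e; move: (G 1 0 1) e => x e.
  transitivity (2 ^+ 3 * x - (0 + 2 * (0 - 0) + 2 * (0 + 2 * (x - 0) - (0 + 2 * (0 - 0))))); first by ring.
  by rewrite -e subrr.
have B3 : G 1 1 0 = 0.
  apply: (cancel (2%:R ^+ 2)) => //; have := hom 2 1 1 0.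
  rewrite !mulr0 !mulr1 (G1 2 2 0) !(G2 _ 2 _) G0 A1 A2 => e; move: (G 1 1 0) e => x e.
  transitivity (2 ^+ 3 * x - (0 + 2 * (0 - 0) + 2 * (0 + 2 * (x - 0) - (0 + 2 * (0 - 0))))); first by ring.
  by rewrite -e subrr.
move=> a b c; rewrite (G1 a) !(G2 _ b) !(G3 _ _ c) G0 A1 A2 A3 B1 B2 B3.
by ring.
Qed.

End SmallCases.

Section Cubics.
Variables (K : fieldType).
Hypothesis charK : [pchar K] =i pred0.

Lemma cubic_affine n (F : {mpoly K[n.+1]}) p w v a : F \is 3.-homog ->
  double_at p F -> v \in val p ->
  ev F (w + a *: v) = ev F w + a * (ev F (w + v) - ev F w).
Proof.
move=> hF dF vp; have [->|v0] := eqVneq v 0.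
  by rewrite scaler0 !addr0 subrr mulr0 addr0.
have sz := size_line_through_double charK w hF dF vp v0.
have E t : ev F (w + t *: v) = (curve_subst (affine_line w v) F)`_0 + (curve_subst (affine_line w v) F)`_1 * t.
  rewrite -curve_subst_line (horner_coef_wide _ sz) !big_ord_recl big_ord0 /=.
  by rewrite expr0 mulr1 addr0 expr1.
have E0 := E 0; have E1 := E 1; rewrite scale0r addr0 in E0; rewrite scale1r in E1.
by rewrite E E0 E1; ring.
Qed.

Lemma spans_exists_outside n (S : {fset proj_space K n}) (W : {vspace 'rV[K]_n.+1}) :
  spans S -> (\dim W <= n)%N -> exists2 p, p \in S & rep p \notin W.
Proof.
move=> Ssp hW; have [/existsP[p pW]|/existsPn h] := boolP [exists p : S, rep (val p) \notin W].
  by exists (val p) => //; apply: valP.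
have : (fullv <= W)%VS.
  rewrite -Ssp big_seq; apply: (big_ind (fun U => U <= W)%VS); first exact: sub0v.
    by move=> U U' hU hU'; rewrite subv_add hU hU'.
  move=> p pS; rewrite line_rep -memvE; have := h [` pS]%fset.
  by rewrite negbK.
by move/dimvS; rewrite dimvf /dim /= mul1n leqNgt ltnS hW.
Qed.

(** In a basis of points of S the cubic is c times the product of the
    coordinates.  Being affine in the direction of a fourth point (a, b, c) as
    well, it forces all pairwise products of a, b, c to vanish. *)
Lemma cubic_singular_bound (S : {fset proj_space K 2}) (F : {mpoly K[3]}) :
  spans S -> F != 0 -> F \is 3.-homog -> (forall p, p \in S -> double_at p F) ->
  (#|` S| <= 3)%N.
Proof.
move=> Ssp F0 hF dF; have two0 : 2%:R != 0 :> K by have /pcharf0P -> := charK.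
have dline (p : proj_space K 2) : \dim (val p : {vspace 'rV[K]_3}) = 1%N.
  exact: eqP (valP p).
have dimD (U : {vspace 'rV[K]_3}) (p : proj_space K 2) : rep p \notin U ->
   \dim (U + val p) = (\dim U).+1.
  move=> pU; rewrite dimv_disjoint_sum ?dline ?addn1 //; apply/eqP.
  rewrite -subv0; apply/subvP => v; rewrite memv_cap => /andP[vU /lineP[c E]].
  rewrite memv0 E scaler_eq0; case: eqP => //= /eqP c0; case/negP: pU.
  by rewrite -[rep p](scalerK c0) -E memvZ.
have [p1 p1S _] : exists2 p, p \in S & rep p \notin (0 : {vspace 'rV[K]_3})%VS.
  by apply: spans_exists_outside; rewrite ?dimv0.
have [p2 p2S p2W] : exists2 p, p \in S & rep p \notin val p1.
  by apply: spans_exists_outside; rewrite ?dline.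
have [p3 p3S p3W] : exists2 p, p \in S & rep p \notin (val p1 + val p2)%VS.
  by apply: spans_exists_outside => //; rewrite dimD // dline.
have coord v : exists a b c, v = a *: rep p1 + b *: rep p2 + c *: rep p3.
  have : v \in (val p1 + val p2 + val p3)%VS.
    suff -> : (val p1 + val p2 + val p3 = fullv)%VS by rewrite memvf.
    by apply/eqP; rewrite eqEdim subvf dimvf /dim /= !dimD // dline.
  case/memv_addP => _ /memv_addP[_ /lineP[a ->] [_ /lineP[b ->] ->]] [_ /lineP[c ->] ->].
  by exists a, b, c.
pose G a b c := ev F (a *: rep p1 + b *: rep p2 + c *: rep p3).
have GE : forall a b c, G a b c = a * b * c * G 1 1 1.
  apply: multiaffine_cubic => //.
  - move=> t a b c; rewrite /G -(homog_evZ t _ hF).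
    by rewrite !scalerDr !scalerA.
  - move=> a b c; have := cubic_affine (b *: rep p2 + c *: rep p3) a hF (dF _ p1S) (mem_rep p1).
    by rewrite /G scale0r scale1r add0r ![_ + _ + _ *: rep p1]addrC !addrA [_ + rep p1]addrC !addrA.
  - move=> a b c; have := cubic_affine (a *: rep p1 + c *: rep p3) b hF (dF _ p2S) (mem_rep p2).
    by rewrite /G scale0r scale1r addr0 ![a *: rep p1 + c *: rep p3 + _]addrAC.
  move=> a b c; have := cubic_affine (a *: rep p1 + b *: rep p2) c hF (dF _ p3S) (mem_rep p3).
  by rewrite /G scale0r scale1r addr0.
have g0 : G 1 1 1 != 0.
  have [u] := mpoly_nonvanishing charK F0; have [a [b [c ->]]] := coord u.
  by rewrite -/(G a b c) GE; apply: contraNneq => ->; rewrite mulr0.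
rewrite leqNgt; apply/negP => S4.
have [p pS pn] : exists2 p, p \in S & p \notin [:: p1; p2; p3].
  apply/allPn; apply: contraL S4 => /allP h; rewrite -leqNgt.
  exact: uniq_leq_size (fset_uniq S) h.
have [a [b [c pE]]] := coord (rep p).
have addE x y z x' y' z' : x *: rep p1 + y *: rep p2 + z *: rep p3 +
    (x' *: rep p1 + y' *: rep p2 + z' *: rep p3) =
    (x + x') *: rep p1 + (y + y') *: rep p2 + (z + z') *: rep p3.
  by rewrite addrACA [X in X + _]addrACA -!scalerDl.
have aff x y z : G (x - a) (y - b) (z - c) =
    G x y z - (G (x + a) (y + b) (z + c) - G x y z).
  have := cubic_affine (x *: rep p1 + y *: rep p2 + z *: rep p3) (-1) hF (dF _ pS) (mem_rep p).
  by rewrite mulN1r -/(G x y z) scaleN1r pE !opprD -!scaleNr !addE.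
have prod0 x y : 2%:R * (x * y * G 1 1 1) = 0 -> (x == 0) || (y == 0).
  by move/eqP; rewrite !mulf_eq0 (negPf two0) (negPf g0) orbF.
have bc : (b == 0) || (c == 0).
  apply: prod0; have := aff 1 0 0; rewrite (GE (_ - a)) (GE (_ + a)) (GE 1 0 0).
  move: (G 1 1 1) => g E; transitivity ((1 - a) * (0 - b) * (0 - c) * g -
    (1 * 0 * 0 * g - ((1 + a) * (0 + b) * (0 + c) * g - 1 * 0 * 0 * g))); first by ring.
  by rewrite E subrr.
have ac : (a == 0) || (c == 0).
  apply: prod0; have := aff 0 1 0; rewrite (GE (_ - a)) (GE (_ + a)) (GE 0 1 0).
  move: (G 1 1 1) => g E; transitivity ((0 - a) * (1 - b) * (0 - c) * g -
    (0 * 1 * 0 * g - ((0 + a) * (1 + b) * (0 + c) * g - 0 * 1 * 0 * g))); first by ring.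
  by rewrite E subrr.
have ab : (a == 0) || (b == 0).
  apply: prod0; have := aff 0 0 1; rewrite (GE (_ - a)) (GE (_ + a)) (GE 0 0 1).
  move: (G 1 1 1) => g E; transitivity ((0 - a) * (0 - b) * (1 - c) * g -
    (0 * 0 * 1 * g - ((0 + a) * (0 + b) * (1 + c) * g - 0 * 0 * 1 * g))); first by ring.
  by rewrite E subrr.
have in_line (q : proj_space K 2) t : rep p = t *: rep q -> q = p.
  by move=> E; apply: rep_in_eq; rewrite E memvZ ?mem_rep.
move: pn; rewrite !inE !negb_or => /and3P[n1 n2 n3].
have [a0|a0] := eqVneq a 0; last first.
  move: ab ac; rewrite (negPf a0) /= => /eqP b0 /eqP c0.
  by case/eqP: n1; apply/esym/(in_line _ a); rewrite pE b0 c0 !scale0r !addr0.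
case/orP: bc => /eqP z.
  by case/eqP: n3; apply/esym/(in_line _ c); rewrite pE a0 z !scale0r !add0r.
by case/eqP: n2; apply/esym/(in_line _ b); rewrite pE a0 z !scale0r add0r addr0.
Qed.

End Cubics.

(** * A configuration with nonzero cohomology *)

Section Existence.
Variables (K : fieldType).
Hypothesis charK : [pchar K] =i pred0.
Variables (n : nat) (a b : 'I_n.+1) (r : nat).
Hypotheses (ab : a != b) (r_gt1 : (1 < r)%N).
Local Notation R := {mpoly K[n.+1]}.
Local Notation V := 'rV[K]_n.+1.
Local Notation Pn := (proj_space K n).
Local Notation Xa := ('X_a : R).
Local Notation Xb := ('X_b : R).

Definition off_line := {j : 'I_n.+1 | (j != a) && (j != b)}.

(** The sum type makes the number of points explicit: r points on the line
    through e_a and e_b, and the coordinate points off this line. *)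
Definition config (x : 'I_r + off_line) : V :=
  match x with
  | inl k => delta_mx 0 a + (k : nat)%:R *: delta_mx 0 b
  | inr j => delta_mx 0 (val j)
  end.

Lemma config_inl k l : config (inl k) 0 l = (l == a)%:R + (k : nat)%:R * (l == b)%:R.
Proof. by rewrite !mxE !eqxx /=. Qed.

Lemma config_inr j l : config (inr j) 0 l = (l == val j)%:R.
Proof. by rewrite !mxE eqxx. Qed.

Lemma config_neq0 x : config x != 0.
Proof.
apply/rV0Pn; case: x => [k|j]; [exists a | exists (val j)].
  by rewrite config_inl eqxx (negPf ab) mulr0 addr0 oner_neq0.
by rewrite config_inr eqxx oner_neq0.
Qed.

Definition config_point x : Pn := exist _ <[config x]>%VS (vline_dim1 (config_neq0 x)).

Lemma config_point_inj : injective config_point.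
Proof.
move=> x y /(congr1 val) /= e.
have : config x \in <[config y]>%VS by rewrite -e memv_line.
case/vlineP => c E; have {}E l : config x 0 l = c * config y 0 l.
  by rewrite E mxE.
case: x y E {e} => [k|[j jP]] [k'|[j' jP']] E.
- have := E a; rewrite !config_inl eqxx (negPf ab) !mulr0 !addr0 mulr1 => c1.
  have := E b; rewrite !config_inl eqxx eq_sym (negPf ab) !add0r !mulr1 -c1 mul1r.
  by move=> /(natr_char0_inj charK) /val_inj ->.
- have := E a; rewrite config_inl config_inr eqxx (negPf ab) mulr0 addr0 /=.
  by case/andP: (jP') => /negPf; rewrite eq_sym => -> _ /eqP; rewrite mulr0 oner_eq0.
- have := E a; rewrite config_inl config_inr eqxx (negPf ab) mulr0 addr0 /= mulr1.
  case/andP: (jP) => /negPf; rewrite eq_sym => -> _ c0.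
  by have /eqP := E j; rewrite config_inr eqxx -c0 mul0r oner_eq0.
have /eqP := E j; rewrite !config_inr /= eqxx; case: (eqVneq j j') => [e _|_]; last first.
  by rewrite mulr0n mulr0 oner_eq0.
by congr inr; apply: val_inj.
Qed.

Definition config_set : {fset Pn} :=
  [fset p in [seq config_point x | x <- enum {: 'I_r + off_line}]]%fset.
Local Notation S := config_set.

Lemma config_setP p : reflect (exists x, p = config_point x) (p \in S).
Proof.
rewrite inE /=; apply: (iffP mapP) => [[x _ ->]|[x ->]]; exists x => //.
by rewrite mem_enum.
Qed.

Lemma card_off_line : #|{: off_line}| = n.-1.
Proof.
rewrite card_sig; have := cardC (pred2 a b); rewrite card2 ab card_ord.
have -> : #|[predC pred2 a b]| = #|[pred j | (j != a) && (j != b)]|.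
  by apply: eq_card => j; rewrite !inE negb_or.
by move=> /(congr1 (fun m => m.-2)) <-; apply: eq_card.
Qed.

Lemma card_config_set : #|` S| = (r + n.-1)%N.
Proof.
rewrite card_fseq undup_id; last by rewrite (map_inj_uniq config_point_inj) enum_uniq.
by rewrite size_map -cardE card_sum card_ord card_off_line.
Qed.

Lemma spans_config_set : spans S.
Proof.
have sub x : (<[config x]> <= \sum_(p <- S) val p)%VS.
  rewrite (big_fsetD1 (config_point x)) /=; first exact: addvSl.
  by apply/config_setP; exists x.
apply/eqP; rewrite eqEsubv subvf; apply/subvP => v _.
rewrite [v]row_sum_delta; apply: memv_suml => j _; apply: memvZ.
have mem x : config x \in (\sum_(p <- S) val p)%VS by rewrite memvE sub.
have ea : delta_mx 0 a \in (\sum_(p <- S) val p)%VS.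
  have := mem (inl (Ordinal (ltnW r_gt1))); by rewrite /= scale0r addr0.
have [->//|ja] := eqVneq j a; have [->|jb] := eqVneq j b.
  have := mem (inl (Ordinal r_gt1)); rewrite /= scale1r => h.
  by rewrite -[delta_mx 0 b](addKr (delta_mx 0 a)) memvD // memvN.
by have := mem (inr (Sub j (introT andP (conj ja jb)))).
Qed.

Lemma config_vanish f d : (f : R) \is d.-homog -> (forall x, ev f (config x) = 0) ->
  vanishing_ideal S f.
Proof.
move=> hf h p /config_setP[x ->] v /vlineP[c ->].
by rewrite (homog_evZ _ _ hf) h mulr0.
Qed.

(** The quadric X_i X_j with i distinct from a and b is zero on the line and at
    all the coordinate points. *)
Lemma quadric_vanish i j : i != j -> (i != a) && (i != b) ->
  vanishing_ideal S ('X_i * 'X_j).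
Proof.
move=> ij /andP[/negPf ia /negPf ib]; apply: (@config_vanish _ 2).
  by rewrite -[2%N]/(1 + 1)%N; apply: dhomogM; apply: homogX1.
case=> [k|l]; rewrite mevalM !mevalXU ?config_inl ?config_inr.
  by rewrite ia ib mulr0 addr0 mul0r.
have [il|_] := eqVneq i (val l); last by rewrite mul0r.
by rewrite -il eq_sym (negPf ij) mulr0.
Qed.

(** It suffices that F lie in the ideal after one multiplication by each
    variable: the degree d component of the localization does not see this. *)
Lemma h0_positive (T : {fset Pn}) d (F : R) : F != 0 -> F \is d.-homog ->
  (forall i, double_ideal T ('X_i * F)) -> h_gt (double_ideal T) d 0 0.
Proof.
move=> F0 hF IF; exists (fun=> [ffun=> tofrac F]); split=> [_|c].
  split; last first.
    by apply/ffunP => s; rewrite (pair_indexE s) differential0E !ffunE subrr.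
  move=> s; exists 1%N, ('X_(s ord0) * F); split=> //.
    by rewrite addnC; apply: dhomogM => //; apply: homogX1.
  by rewrite ffunE big_ord1 expr1 tofracM mulrAC divff ?mul1r // tofrac_eq0 mpolyX_neq0.
rewrite /is_coboundary => /ffunP/(_ [ffun=> ord0]); rewrite !ffunE big_ord1 => /eqP.
rewrite mulf_eq0 !tofrac_eq0 (negPf F0) orbF mpolyC_eq0 => /eqP c0 i.
by rewrite ord1.
Qed.

Definition line_factor (t : K) : R := Xb - t%:MP * Xa.

Lemma line_factor_homog t : line_factor t \is 1.-homog.
Proof. by rewrite /line_factor mul_mpolyC; apply: rpredB; [|apply: rpredZ]; apply: homogX1. Qed.

Lemma prod_line_factor_homog (rs : seq K) : \prod_(t <- rs) line_factor t \is (size rs).-homog.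
Proof.
elim: rs => [|t rs IH]; first by rewrite big_nil dhomog1.
by rewrite big_cons -[size _]/(1 + size rs)%N; apply: dhomogM => //; apply: line_factor_homog.
Qed.

(** Every factor is X_b modulo X_a.  This splits the class
    P^2 / (X_a X_b^beta) into a fraction with a pole along X_b = 0 only and one
    with a pole along X_a = 0 only. *)
Lemma prod_line_factor_split t0 (rs : seq K) : exists A : R, A \is (size rs).-homog /\
  \prod_(t <- t0 :: rs) line_factor t = Xa * A + Xb ^+ (size rs).+1.
Proof.
elim: rs t0 => [|t1 rs IH] t0.
  exists (- t0%:MP); split; last by rewrite big_seq1 /line_factor; ring.
  by rewrite -mpolyCN -[_%:MP]mulr1 mul_mpolyC; apply: rpredZ; apply: dhomog1.
have [A [hA EA]] := IH t1.
exists (line_factor t0 * A - t0%:MP * Xb ^+ (size rs).+1); split.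
  rewrite mul_mpolyC; apply: rpredB; last by apply: rpredZ; apply: homogXn.
  by rewrite -[size _]/(1 + size rs)%N; apply: dhomogM => //; apply: line_factor_homog.
rewrite big_cons EA /line_factor -[size (t1 :: rs)]/(size rs).+1 [in RHS](exprS _ (size rs).+1); ring.
Qed.

Let slopes : seq K := [seq k%:R | k <- iota 0 r].
Let P : R := \prod_(t <- slopes) line_factor t.

Lemma P_vanish : vanishing_ideal S P.
Proof.
apply: (config_vanish (prod_line_factor_homog slopes)) => x; rewrite rmorph_prod /=.
suff [t trs t0] : exists2 t, t \in slopes & ev (line_factor t) (config x) = 0.
  by rewrite (big_rem t) //= t0 mul0r.
case: x => [k|j].
  exists (k : nat)%:R; first by apply: map_f; rewrite mem_iota /=.
  rewrite mevalB mevalM mevalC !mevalXU !config_inl !eqxx (negPf ab) eq_sym (negPf ab).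
  by rewrite mulr0 add0r addr0 !mulr1 subrr.
exists 0; first by apply/mapP; exists 0%N; rewrite // mem_iota /=; apply: ltnW.
rewrite mevalB mevalM mevalC !mevalXU !config_inr mul0r subr0.
by case/andP: (valP j) => _ /negPf; rewrite eq_sym => ->.
Qed.

Variables (d beta : nat).
Hypotheses (beta_gt0 : (0 < beta)%N) (r_beta : (2 * r = d + 1 + beta)%N).

Lemma P2_split : exists A : R, A \is (d + beta).-homog /\
  P ^+ 2 = Xa * A + Xb ^+ (d + 1 + beta).
Proof.
have sz : size (slopes ++ slopes) = (d + beta).+1.
  by rewrite size_cat size_map size_iota; lia.
case E : (slopes ++ slopes) sz => [|t rs] //= [sz].
have [A [hA EA]] := prod_line_factor_split t rs; exists A; rewrite sz in hA EA; split=> //.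
by rewrite expr2 /P -big_cat E EA addn1 addSn.
Qed.

Lemma P2_homog : P ^+ 2 \is (d + 1 + beta).-homog.
Proof.
rewrite -r_beta mulnC; apply: dhomogMn.
by have := prod_line_factor_homog slopes; rewrite size_map size_iota.
Qed.

Lemma config_vanish_root f k : vanishing_ideal S f -> (k < r)%N ->
  f.@[fun j => (j == a)%:R + k%:R * (j == b)%:R] = 0.
Proof.
move=> fS kr; have := fS _ (introT (config_setP _) (ex_intro _ (inl (Ordinal kr)) erefl)).
move/(_ _ (memv_line _)) => /= <-; apply: meval_eq => j.
by rewrite (config_inl (Ordinal kr)).
Qed.

(** The substitution X_a = 1, X_b = T, which restricts forms to the line. *)
Let param (j : 'I_n.+1) : {poly K} :=
  if j == a then 1 else if j == b then 'X else 0.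
Let P1 : {poly K} := \prod_(t <- slopes) ('X - t%:P).

Lemma param_horner j t : (param j).[t] = (j == a)%:R + t * (j == b)%:R.
Proof.
rewrite /param; have [->|_] := eqVneq j a.
  by rewrite hornerC (negPf ab) mulr0 addr0.
by case: eqP => _; rewrite ?hornerX ?horner0 ?mulr1 ?mulr0 add0r.
Qed.

Lemma size_param j : (size (param j) <= 2)%N.
Proof.
by rewrite /param; do 2?case: eqP => _; rewrite ?size_poly1 ?size_polyX ?size_poly0.
Qed.

Lemma curve_subst_paramX j : curve_subst param 'X_j = param j.
Proof. by rewrite /curve_subst mmapX mmap1U. Qed.

Lemma curve_subst_paramP : curve_subst param P = P1.
Proof.
rewrite /curve_subst rmorph_prod; apply: eq_bigr => t _ /=.
rewrite rmorphB rmorphM /= mmapC -!/(curve_subst param _) !curve_subst_paramX /param eqxx.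
by rewrite eq_sym (negPf ab) eqxx mulr1.
Qed.

Lemma dvd_subst_double f : double_ideal S f -> P1 ^+ 2 %| curve_subst param f.
Proof.
have dvd g : vanishing_ideal S g -> P1 %| curve_subst param g.
  move=> gS; apply: uniq_roots_dvdp.
    apply/allP => _ /mapP[k + ->]; rewrite mem_iota add0n => /andP[_ kr].
    apply/rootP; rewrite curve_subst_horner -[RHS](config_vanish_root gS kr).
    by apply: meval_eq => j; rewrite param_horner.
  by rewrite uniq_rootsE map_inj_uniq ?iota_uniq //; apply: natr_char0_inj.
move=> [m [f1 [f2 [h1 h2 ->]]]]; rewrite /curve_subst rmorph_sum /=.
apply: (big_ind (dvdp _)); first exact: dvdp0.
  by move=> y z; apply: dvdp_add.
by move=> i _; rewrite rmorphM expr2; apply: dvdp_mul; apply: dvd.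
Qed.

(** Sections over the intersection of two charts, with a denominator that is
    visibly symmetric in i and j. *)
Let overlap_section i j x := exists m (f : R), [/\ double_ideal S f, f \is (d + m * 2).-homog
  & x = tofrac f / tofrac (('X_i * 'X_j) ^+ m)].

Lemma overlap_is_section i j x : overlap_section i j x -> is_section (double_ideal S) d (pair_index i j) x.
Proof.
move=> [m [f [h1 h2 ->]]]; exists m, f; split=> //.
by rewrite !big_ord_recl big_ord0 !ffunE mulr1.
Qed.

Lemma overlap_sectionN i j x : overlap_section i j x -> overlap_section j i (- x).
Proof.
move=> [m [f [h1 h2 ->]]]; exists m, (- f); split.
- by rewrite -mulN1r; apply: double_idealM.
- by rewrite rpredN.
- by rewrite tofracN mulNr ['X_j * _]mulrC.
Qed.

Lemma overlap_section0 i j : overlap_section i j 0.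
Proof.
exists 0%N, 0; split; first exact: ideal_square0; first exact: rpred0.
by rewrite tofrac0 mul0r.
Qed.

Lemma tofrac_ratio_scale (f g h : R) : g != 0 ->
  tofrac f / tofrac h = tofrac (g * f) / tofrac (g * h).
Proof.
by move=> g0; rewrite !tofracM -mulf_div divff ?mul1r // tofrac_eq0.
Qed.

Lemma XX_neq0 i j m : ('X_i * 'X_j : R) ^+ m != 0.
Proof. by rewrite expf_neq0 // mulf_neq0 ?mpolyX_neq0. Qed.

(** The quadric X_i X_j vanishes on the configuration, so its square is in the
    squared ideal, and a Laurent form may be multiplied and divided by it. *)
Lemma overlap_section_away i j m (f : R) : i != j -> (j != a) && (j != b) ->
  f \is (d + m).-homog -> overlap_section i j (tofrac f / tofrac ('X_i ^+ m)).
Proof.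
move=> ij jab hf.
exists (2 + m)%N, (('X_i * 'X_j) ^+ 2 * ('X_j ^+ m * f)); split.
- rewrite mulrC expr2; apply: double_idealM; apply: ideal_square_mul;
    by rewrite mulrC; apply: quadric_vanish => //; rewrite eq_sym.
- have -> : (d + (2 + m) * 2 = 2 * 2 + (m + (d + m)))%N by lia.
  apply: dhomogM; last by apply: dhomogM => //; apply: homogXn.
  by apply: dhomogMn; rewrite -[2%N]/(1 + 1)%N; apply: dhomogM; apply: homogX1.
have Xj0 : 'X_j ^+ m != 0 :> R by rewrite expf_neq0 ?mpolyX_neq0.
rewrite (tofrac_ratio_scale _ _ Xj0) (tofrac_ratio_scale _ _ (XX_neq0 i j 2)).
by congr (_ / tofrac _); rewrite exprD ['X_j ^+ m * _]mulrC -exprMn.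
Qed.

Lemma overlap_section_line (A : R) : A \is (d + beta).-homog ->
  P ^+ 2 = Xa * A + Xb ^+ (d + 1 + beta) ->
  overlap_section a b (tofrac A / tofrac (Xb ^+ beta) + tofrac (Xb ^+ (d + 1)) / tofrac (Xa ^+ 1)).
Proof.
move=> hA EP; exists beta, (Xa ^+ beta.-1 * P ^+ 2); split.
- by apply: double_idealM; rewrite expr2; apply: ideal_square_mul; apply: P_vanish.
- have -> : (d + beta * 2 = beta.-1 + (d + 1 + beta))%N by lia.
  by apply: dhomogM; [apply: homogXn | apply: P2_homog].
rewrite addf_div ?tofracXn_neq0 // -!tofracM -tofracD.
have Xj0 : Xa ^+ beta.-1 != 0 :> R by rewrite expf_neq0 ?mpolyX_neq0.
rewrite [LHS](tofrac_ratio_scale _ _ Xj0); congr (tofrac _ / tofrac _).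
  by rewrite EP (exprD _ (d + 1) beta) expr1 [A * _]mulrC.
have Xbeta : Xa ^+ beta = Xa ^+ beta.-1 * Xa by rewrite -exprSr prednK.
by rewrite exprMn Xbeta expr1 -mulrA [Xa * _]mulrC.
Qed.

Lemma clear_denominators (F : fieldType) (c q x yb ym xm f g : F) :
  x != 0 -> yb != 0 -> ym != 0 -> xm != 0 ->
  c * (q / (x * yb)) = f / ym - g / xm ->
  c * q * xm * ym = f * x * xm * yb - g * x * yb * ym.
Proof.
move=> x0 y0 ym0 xm0 E.
have -> : c * q * xm * ym = c * (q / (x * yb)) * (x * yb * xm * ym).
  by field; rewrite x0 y0.
by rewrite E; field; rewrite xm0 ym0.
Qed.

(** Comparison of sizes: the left-hand side of
    (c + ua T^beta) T^m = ub T^beta has size larger than m unless it is zero,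
    and then the value at 0 gives c = 0. *)
Lemma no_mixed_pole (c : K) (ua ub : {poly K}) m :
  (ub != 0 -> (beta + size ub <= m)%N) -> c%:P * 'X^m = ub * 'X^beta - ua * 'X^(beta + m) -> c = 0.
Proof.
move=> hs E; apply/eqP; apply: contraT => c0.
have {}E : (c%:P + ua * 'X^beta) * 'X^m = ub * 'X^beta.
  by rewrite mulrDl E -mulrA -exprD subrK.
have nz : c%:P + ua * 'X^beta != 0.
  apply: contraNneq c0 => /(congr1 (horner^~ 0)).
  by rewrite hornerD hornerC hornerM hornerXn expr0n gtn_eqF //= mulr0 addr0 horner0 => ->.
have /(congr1 (fun p : {poly K} => size p)) := E; rewrite size_mulXn //.
have nz' : ub != 0.
  apply: contraNneq nz => u0; move/eqP: E; rewrite u0 mul0r mulf_eq0.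
  by rewrite (negPf (monic_neq0 (monicXn _ _))) orbF.
rewrite size_mulXn // => e; have {}hs := hs nz'.
have := size_poly_gt0 (c%:P + ua * 'X^beta); rewrite nz; lia.
Qed.

(** The cochain is the difference of the local fractions g i, so it is a cocycle.
    Its components lie in the squared ideal thanks to P^2 for the indices a and
    b, thanks to the quadrics X_i X_j if exactly one index is a or b, and they
    are zero otherwise.  The equation of a coboundary, restricted to the line
    and divided by P^2, contradicts [no_mixed_pole]. *)
Theorem h1_positive : h_gt (double_ideal S) d 1 0.
Proof.
have [A [hA EP]] := P2_split.
pose g i : {fraction R} := if i == a then - (tofrac (Xb ^+ (d + 1)) / tofrac (Xa ^+ 1))
  else if i == b then tofrac A / tofrac (Xb ^+ beta) else 0.
have ga : g a = - (tofrac (Xb ^+ (d + 1)) / tofrac (Xa ^+ 1)) by rewrite /g eqxx.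
have gb : g b = tofrac A / tofrac (Xb ^+ beta) by rewrite /g eq_sym (negPf ab) eqxx.
have g0 i : i != a -> i != b -> g i = 0 by rewrite /g => /negPf -> /negPf ->.
pose c : cochain K n 1 := [ffun s : {ffun 'I_2 -> 'I_n.+1} => g (s 1) - g (s 0)].
have cE i j : c (pair_index i j) = g j - g i by rewrite !ffunE.
have section_ab : overlap_section a b (g b - g a) by rewrite ga gb opprK; apply: overlap_section_line.
have section_half i j : (i == a) || (i == b) -> (j != a) && (j != b) -> overlap_section i j (g j - g i).
  move=> iab jab; rewrite (g0 j); try by case/andP: jab.
  have ij : i != j by apply: contraTneq iab => ->; rewrite negb_or.
  rewrite sub0r; case/orP: iab ij => /eqP -> ij.
    by rewrite ga opprK; apply: overlap_section_away => //; apply: homogXn.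
  by rewrite gb -mulNr -tofracN; apply: overlap_section_away => //; rewrite rpredN.
have section_all i j : overlap_section i j (g j - g i).
  have [iab|iab] := boolP ((i == a) || (i == b)); last first.
    have [jab|jab] := boolP ((j == a) || (j == b)).
      by rewrite -opprB; apply/overlap_sectionN/section_half; rewrite // -negb_or.
    move: iab jab; rewrite !negb_or => /andP[? ?] /andP[? ?].
    by rewrite !g0 // subrr; apply: overlap_section0.
  have [jab|jab] := boolP ((j == a) || (j == b)); last first.
    by apply: section_half; rewrite // -negb_or.
  case/orP: iab => /eqP ->; case/orP: jab => /eqP ->; rewrite ?subrr; try exact: overlap_section0.
    exact: section_ab.
  by rewrite -opprB; apply: overlap_sectionN.
exists (fun=> c); split=> [_|z].
  split; first by move=> s; rewrite (pair_indexE s) cE; apply/overlap_is_section.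
  apply/ffunP => s; rewrite (triple_indexE s) differential1E !cE [RHS]ffunE.
  by move: (g _) (g _) (g _) => x y z; ring.
move=> [h hh E] i; rewrite ord1 {i}.
have := congr1 (fun k : cochain K n 1 => k (pair_index a b)) E.
rewrite differential0E [LHS]ffunE big_ord1 cE ga gb opprK.
have [ma [fa [faS hfa ->]]] := hh [ffun=> a].
have [mb [fb [fbS hfb ->]]] := hh [ffun=> b].
rewrite !big_ord1 !ffunE addf_div ?tofracXn_neq0 // -!tofracM -tofracD.
have -> : A * Xa ^+ 1 + Xb ^+ (d + 1) * Xb ^+ beta = P ^+ 2.
  by rewrite EP (exprD _ (d + 1) beta) expr1 [A * _]mulrC.
rewrite [Xb ^+ beta * _]mulrC [in X in _ / X]tofracM.
have xa := tofracXn_neq0 K a; have xb := tofracXn_neq0 K b.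
move=> H; have {}H := clear_denominators (xa 1%N) (xb beta) (xb mb) (xa ma) H.
move: H; rewrite -!tofracM -tofracB => /eqP; rewrite tofrac_eq => /eqP H.
have [ub Eb] := dvdpP _ _ (dvd_subst_double fbS).
have [ua Ea] := dvdpP _ _ (dvd_subst_double faS).
have P1n0 : P1 ^+ 2 != 0 by rewrite expf_neq0 // monic_neq0 // monic_prod_XsubC.
have sP1 : size (P1 ^+ 2) = (2 * r).+1.
  rewrite -(prednK (n := size _)) ?size_poly_gt0 // size_exp /P1 size_prod_XsubC.
  by rewrite size_map size_iota mulnC.
have sb : ub != 0 -> (beta + size ub <= mb)%N.
  move=> u0; have := size_curve_subst size_param hfb; rewrite Eb muln1.
  by rewrite size_mul // sP1; move: (size ub) => t; lia.
apply: (no_mixed_pole (ua := ua) sb); apply: (mulIf P1n0).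
have {H} := congr1 (curve_subst param) H.
rewrite /curve_subst rmorphB !rmorphM !rmorphXn /= mmapC -!/(curve_subst param _).
rewrite !curve_subst_paramX curve_subst_paramP Ea Eb.
have -> : param a = 1 by rewrite /param eqxx.
have -> : param b = 'X by rewrite /param eq_sym (negPf ab) eqxx.
rewrite !expr1n !mulr1 => H.
by rewrite mulrAC H exprD; ring.
Qed.

End Existence.

(** * Nonemptiness and the theorem *)

Section SingularMonomials.
Variables (K : fieldType) (n : nat) (a b : 'I_n.+1) (r d : nat).
Hypothesis ab : a != b.
Local Notation R := {mpoly K[n.+1]}.
Local Notation S := (config_set K r ab).

(** X_c X_a vanishes on the configuration, so its square times any form of
    degree d - 4 will do. *)
Lemma h0_positive_high_degree c : (c != a) && (c != b) -> (3 < d)%N ->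
  h_gt (double_ideal S) d 0 0.
Proof.
move=> cab d4; have ac : c != a by case/andP: cab.
apply: (@h0_positive _ _ _ _ (('X_c * 'X_a) ^+ 2 * 'X_a ^+ (d - 4))).
- by rewrite mulf_neq0 ?XX_neq0 // expf_neq0 ?mpolyX_neq0.
- rewrite -[X in X.-homog](subnKC d4 : (2 * 2 + (d - 4))%N = d).
  apply: dhomogM; last exact: homogXn.
  by apply: dhomogMn; rewrite -[2%N]/(1 + 1)%N; apply: dhomogM; apply: homogX1.
- move=> i; apply: double_idealM; rewrite mulrC; apply: double_idealM.
  by rewrite expr2; apply: ideal_square_mul; apply: quadric_vanish.
Qed.

(** X_c X_e X_a is not in the squared ideal but becomes so after
    multiplication by any variable, being then a product of two quadrics of the
    configuration. *)
Lemma h0_positive_cubic c e : (c != a) && (c != b) -> (e != a) && (e != b) ->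
  c != e -> h_gt (double_ideal S) 3 0 0.
Proof.
move=> cab eab ce; have ca : c != a by case/andP: cab.
have ea : e != a by case/andP: eab.
apply: (@h0_positive _ _ _ _ ('X_c * ('X_e * 'X_a))).
- by rewrite !mulf_neq0 ?mpolyX_neq0.
- by rewrite -[3%N]/(1 + (1 + 1))%N; do 2?apply: dhomogM; apply: homogX1.
move=> i; have [->|ic] := eqVneq i c.
  have -> : 'X_c * ('X_c * ('X_e * 'X_a)) = ('X_c * 'X_e) * ('X_c * 'X_a) :> R by ring.
  by apply: ideal_square_mul; apply: quadric_vanish.
have -> : 'X_i * ('X_c * ('X_e * 'X_a)) = ('X_c * 'X_i) * ('X_e * 'X_a) :> R by ring.
by apply: ideal_square_mul; apply: quadric_vanish; rewrite // eq_sym.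
Qed.

End SingularMonomials.

Local Open Scope nat_scope.

Theorem theorem1p1 (K : closedFieldType) (charK : [pchar K]%R =i pred0)
    (n d x : nat) (n_gt0 : 0 < n) (d_gt0 : 0 < d) (x_gt0 : 0 < x) :
  [/\ (n = 1 \/ d = 2 ->
         ~ exists S : {fset proj_space K n}, terracini d x S),
      (n = 2 /\ d = 3 ->
         ~ exists S : {fset proj_space K n}, terracini d x S)
    & (2 <= n -> 3 <= d -> (n, d) <> (2, 3) ->
         ((exists S : {fset proj_space K n}, terracini d x S) <->
          n + uphalf d <= x))].
Proof.
split.
- case=> [n1|d2] [S [Sx h0 h1 Ssp]]; have [F [F0 hF dF]] := h0_gives_form n_gt0 h0.
    subst n; have := binary_singular_bound charK Ssp F0 hF dF.
    by move=> le; case: (h1_vanishing Ssp _ h1); rewrite muln1 add2n ltnS ltnW.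
  by subst d; case/eqP: F0; apply: quadric_singular_zero dF.
- case=> n2 d3 [S [Sx h0 h1 Ssp]]; have [F [F0 hF dF]] := h0_gives_form n_gt0 h0.
  subst n d; have := cubic_singular_bound charK Ssp F0 hF dF.
  by move=> le; case: (h1_vanishing Ssp _ h1); rewrite (leq_ltn_trans (leq_mul (leqnn 2) le)).
move=> n2 d3 nd; split=> [[S [Sx h0 h1 Ssp]]|le].
  rewrite leqNgt; apply/negP => lt; apply: (h1_vanishing Ssp _ h1); rewrite Sx.
  by have := odd_double_half d; have := uphalf_half d; case: (odd d) => /=; lia.
pose i0 : 'I_n.+1 := ord0.
pose i1 : 'I_n.+1 := inord 1.
pose i2 : 'I_n.+1 := inord 2.
have v1 : i1 = 1 :> nat by rewrite inordK //; lia.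
have v2 : i2 = 2 :> nat by rewrite inordK //; lia.
have i01 : i0 != i1 by rewrite -val_eqE /= v1.
pose r := x - n.-1.
have r_ge : d + 2 <= 2 * r.
  by have := odd_double_half d; have := uphalf_half d; rewrite /r; case: (odd d) => /=; lia.
have r1 : 1 < r by lia.
exists (config_set K r i01); split.
- rewrite (card_config_set charK) /r subnK //; lia.
- have i2ok : (i2 != i0) && (i2 != i1) by rewrite -!val_eqE /= v1 v2.
  have [d4|d_le3] := ltnP 3 d; first exact: h0_positive_high_degree i2ok d4.
  have E : d = 3 by lia.
  have n3 : 2 < n.
    by rewrite ltn_neqAle n2 andbT; apply/eqP => e; apply: nd; rewrite -e E.
  pose i3 : 'I_n.+1 := inord 3.
  have v3 : i3 = 3 :> nat by rewrite inordK.
  rewrite E; apply: h0_positive_cubic i2ok _ (_ : i2 != i3);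
    by rewrite -!val_eqE /= ?v1 ?v2 v3.
- by apply: (@h1_positive _ charK _ _ _ _ _ r1 _ (2 * r - d - 1)); lia.
- exact: spans_config_set.
Qed.
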